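(* Let $W=W_{D_n}$. The action of $\eta_i$ on the $\mathbb H_W$-module $\mathcal C[\xi_1,\dots,\xi_n]$ is realized as the Dunkl operator $$\eta_i=t\,\partial_{\xi_i}+u\sum_{k\ne i}\frac2{\xi_i^2-\xi_k^2}\Big((\xi_i-\xi_k)s_{ik}-(\xi_i\tau_i-\xi_k\tau_k)\Big).$$
   Context: All algebras are over $\mathbb C$; $[a,b]_+=ab+ba$. $W_{D_n}$ is the group of even signed permutations of $1,\dots,n$; $s_{ij}$ is the transposition of $i,j$, $\overline s_{ij}$ the transposition of $i,j$ coupled with sign changes at $i,j$. $W\to S_n$, $\sigma\mapsto\sigma^*$, is the homomorphism forgetting signs ($s_{ij}^*=\overline s_{ij}^*=s_{ij}$); $S_n$ permutes the indices of the $\xi_j$ and of the $\eta_j$. $\mathcal C[\xi_1,\dots,\xi_n]$ is the skew-polynomial algebra generated by $\xi_i$ with $\xi_i\xi_j=-\xi_j\xi_i$ for $i\ne j$ (no condition on $\xi_i^2$). Let $t,u\in\mathbb C$. The odd double affine Hecke algebra $\mathbb H_W$ of type $D_n$ is generated by $\xi_i,\eta_i$ ($1\le i\le n$) and $\mathbb C W$ subject to: $\eta_i\eta_j=-\eta_j\eta_i$, $\xi_i\xi_j=-\xi_j\xi_i$ ($i\ne j$); $\sigma\xi_j=\xi_j^{\sigma^*}\sigma$, $\sigma\eta_j=\eta_j^{\sigma^*}\sigma$ ($\sigma\in W$); $[\eta_i,\xi_j]_+=u(s_{ij}+\overline s_{ij})$ ($i\ne j$), $[\eta_i,\xi_i]_+=t+u\sum_{k\ne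 i}(s_{ki}+\overline s_{ki})$. The module: let $\mathfrak h_\eta\subset\mathbb H_W$ be the subalgebra generated by the $\eta_i$ and $\mathbb C W$; let $V$ be the trivial one-dimensional $\mathbb C W$-module, extended to $\mathfrak h_\eta$ by letting each $\eta_i$ act by $0$. The induced module $\mathrm{Ind}_{\mathfrak h_\eta}^{\mathbb H_W}V$ is identified with $\mathcal C[\xi_1,\dots,\xi_n]$; here $\xi_i$ acts by left multiplication and $\sigma\in W$ acts as $f\mapsto f^{\sigma^*}$. In the formula the symbols are operators on $\mathcal C[\xi_1,\dots,\xi_n]$: $s_{ik}$ is the algebra automorphism exchanging $\xi_i$ and $\xi_k$; $\tau_i$ is the sign-change automorphism $\xi_i\mapsto-\xi_i$, $\xi_j\mapsto\xi_j$ ($j\ne i$); $\xi_i$ is left multiplication; $\xi_i^2-\xi_k^2$ is central, and division by it is applied to the result (which is divisible by it). $\partial_{\xi_i}$ is the super derivation with $\partial_{\xi_i}(\xi_j)=\delta_{ij}$ and $\partial_{\xi_i}(\xi_{a_1}\cdots\xi_{a_l})=\sum_k(-1)^{k-1}\xi_{a_1}\cdots\xi_{a_{k-1}}\partial_{\xi_i}(\xi_{a_k})\xi_{a_{k+1}}\cdots\xi_{a_l}$. *)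

(* Defs.v *)
From HB Require Import structures.
From mathcomp Require Import all_boot all_algebra all_fingroup.
From mathcomp Require Import generic_quotient ring_quotient finmap.
From mathcomp Require Import boolp classical_sets reals complex.
From mathcomp Require Import monalg.

Set Implicit Arguments.
Unset Strict Implicit.
Unset Printing Implicit Defensive.

Import GRing.Theory.
Local Open Scope ring_scope.
Local Open Scope quotient_scope.

(* The free R-module with basis [fbase t], t in T. The operations of [malg] are
   locked because their unfolding makes unification explode. *)
Fact free_key : unit. Proof. exact: tt. Qed.

Section FreeModule.
Variables (R : nzRingType) (T : choiceType).

Definition free_mod : Type := {malg R[T]}.
HB.instance Definition _ := Choice.on free_mod.
Implicit Types (x y : free_mod).

Definition fzero : free_mod := locked_with free_key (0 : {malg R[T]}).
Definition fopp : free_mod -> free_mod :=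
  locked_with free_key (fun x : {malg R[T]} => - x).
Definition fadd : free_mod -> free_mod -> free_mod :=
  locked_with free_key (fun x y : {malg R[T]} => x + y).
Definition fscale : R -> free_mod -> free_mod :=
  locked_with free_key (fun (c : R) (x : {malg R[T]}) => c *: x).
Definition fbase : T -> free_mod :=
  locked_with free_key (fun t => << t >> : {malg R[T]}).

Fact faddA : associative fadd.
Proof. by rewrite /fadd unlock; apply: addrA. Qed.
Fact faddC : commutative fadd.
Proof. by rewrite /fadd unlock; apply: addrC. Qed.
Fact fadd0 : left_id fzero fadd.
Proof. by rewrite /fadd /fzero !unlock; apply: add0r. Qed.
Fact faddN : left_inverse fzero fopp fadd.
Proof. by rewrite /fadd /fzero /fopp !unlock; apply: addNr. Qed.
HB.instance Definition _ :=
  GRing.isZmodule.Build free_mod faddA faddC fadd0 faddN.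

Lemma faddE x y : x + y = (x : {malg R[T]}) + y :> {malg R[T]}.
Proof. by rewrite [LHS]/GRing.add /= /fadd unlock. Qed.

Fact fscaleA a b x : fscale a (fscale b x) = fscale (a * b) x.
Proof. by rewrite /fscale unlock; apply: scalerA. Qed.
Fact fscale1 : left_id 1 fscale.
Proof. by rewrite /fscale unlock; apply: scale1r. Qed.
Fact fscaleDr : right_distributive fscale +%R.
Proof.
by move=> c x y; rewrite faddE [in RHS]faddE /fscale unlock; apply: scalerDr.
Qed.
Fact fscaleDl x : {morph fscale^~ x : a b / a + b}.
Proof.
by move=> a b; rewrite faddE /fscale unlock; apply: scalerDl.
Qed.
HB.instance Definition _ := GRing.Zmodule_isLmodule.Build R free_mod
  fscaleA fscale1 fscaleDr fscaleDl.

Lemma fscaleE c x : c *: x = c *: (x : {malg R[T]}) :> {malg R[T]}.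
Proof. by rewrite [LHS]/GRing.scale /= /fscale unlock. Qed.

Lemma free_mod_ind (P : free_mod -> Prop) :
  P 0 -> (forall c t x, P x -> P (c *: fbase t + x)) -> forall x, P x.
Proof.
move=> P0 PD x.
have -> : x = \sum_(k <- msupp x) << x@_k *g k >> :> {malg R[T]}.
  exact: monalgE.
elim: (X in \sum_(_ <- X) _) => [|k r IH].
  by rewrite big_nil; move: P0; rewrite [0]/GRing.zero /= /fzero unlock.
rewrite big_cons; have := PD (x@_k) k _ IH; rewrite faddE fscaleE /fbase unlock.
suff -> : x@_k *: (<< k >> : {malg R[T]}) = << x@_k *g k >> by [].
by apply/malgP => l; rewrite mcoeffZ 2!mcoeffU mulrnAr mulr1.
Qed.

Section Lift.
Variables (M : lmodType R) (f : T -> M).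

(* The linear map with fbase t |-> f t. *)
Definition flift : free_mod -> M := locked_with free_key
  (fun x : {malg R[T]} => \sum_(k <- msupp x) x@_k *: f k).

Lemma fliftEw (d : {fset T}) (x : {malg R[T]}) : (msupp x `<=` d)%fset ->
  flift x = \sum_(k <- d) x@_k *: f k.
Proof.
move=> le; rewrite /flift unlock (big_fset_incl _ le) => //= k kd.
by move/mcoeff_outdom ->; rewrite scale0r.
Qed.

Lemma flift_base t : flift (fbase t) = f t.
Proof.
by rewrite /fbase unlock (fliftEw (msuppU_le (k := t) (x := 1))) big_seq_fset1 mcoeffUU scale1r.
Qed.

Fact flift_is_semilinear : semilinear flift.
Proof.
split.
  move=> c x; pose d := (msupp (c *: (x : {malg R[T]})) `|` msupp x)%fset.
  rewrite fscaleE (@fliftEw d _ (fsubsetUl _ _)) (@fliftEw d x (fsubsetUr _ _)).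
  by rewrite scaler_sumr; apply: eq_bigr => k _; rewrite mcoeffZ scalerA.
move=> x y.
pose d := (msupp ((x : {malg R[T]}) + y) `|` (msupp x `|` msupp y))%fset.
have lx : (msupp x `<=` d)%fset.
  exact: fsubset_trans (fsubsetUl _ _) (fsubsetUr _ _).
have ly : (msupp y `<=` d)%fset.
  exact: fsubset_trans (fsubsetUr _ _) (fsubsetUr _ _).
rewrite faddE (@fliftEw d _ (fsubsetUl _ _)) (fliftEw lx) (fliftEw ly).
by rewrite -big_split; apply: eq_bigr => k _; rewrite mcoeffD scalerDl.
Qed.
HB.instance Definition _ :=
  GRing.isSemilinear.Build R free_mod M *:%R flift flift_is_semilinear.

End Lift.
End FreeModule.

Section FreeAlgebra.
Variables (K : comNzRingType) (I : choiceType).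

Definition free_alg : Type := free_mod K (seq I).
HB.instance Definition _ := GRing.Lmodule.on free_alg.
Implicit Types (x y z : free_alg).

Definition word (s : seq I) : free_alg := fbase K s.
Definition gen (i : I) : free_alg := word [:: i].

Definition word_mull (s : seq I) : free_alg -> free_alg :=
  flift (fun r => word (s ++ r)).
HB.instance Definition _ s := GRing.Linear.on (word_mull s).

Definition free_mul : free_alg -> free_alg -> free_alg := locked_with free_key
  (fun x y => flift (fun s => word_mull s y) x).

Lemma free_mulE x y : free_mul x y = flift (fun s => word_mull s y) x.
Proof. by rewrite /free_mul unlock. Qed.

Lemma free_alg_ind (P : free_alg -> Prop) :
  P 0 -> (forall c s x, P x -> P (c *: word s + x)) -> forall x, P x.
Proof. exact: free_mod_ind. Qed.

Lemma word_mullE s r : word_mull s (word r) = word (s ++ r).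
Proof. exact: flift_base. Qed.

Lemma free_mul_word s y : free_mul (word s) y = word_mull s y.
Proof. by rewrite free_mulE; apply: flift_base. Qed.

Fact free_mulDl : left_distributive free_mul +%R.
Proof. by move=> x y z; rewrite 3!free_mulE; apply: raddfD. Qed.

Fact free_mulZl c x y : free_mul (c *: x) y = c *: free_mul x y.
Proof. by rewrite 2!free_mulE; apply: linearZ. Qed.

Fact free_mul0l y : free_mul 0 y = 0.
Proof. by rewrite free_mulE; apply: raddf0. Qed.

Fact free_mulDr : right_distributive free_mul +%R.
Proof.
move=> x y z; elim/free_alg_ind: x => [|c s x IH].
  by rewrite !free_mul0l addr0.
by rewrite !free_mulDl IH !free_mulZl !free_mul_word raddfD scalerDr addrACA.
Qed.

Fact free_mulZr c x y : free_mul x (c *: y) = c *: free_mul x y.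
Proof.
elim/free_alg_ind: x => [|d s x IH]; first by rewrite !free_mul0l scaler0.
rewrite !free_mulDl IH !free_mulZl !free_mul_word linearZ scalerDr /=.
by rewrite !scalerA mulrC.
Qed.

Fact free_mul0r x : free_mul x 0 = 0.
Proof. by have := free_mulZr 0 x 0; rewrite !scale0r. Qed.

Fact free_mulA : associative free_mul.
Proof.
move=> x y z; elim/free_alg_ind: x => [|c s x IH].
  by rewrite !free_mul0l.
rewrite !free_mulDl IH; congr (_ + _); rewrite !free_mulZl; congr (_ *: _).
elim/free_alg_ind: {IH} y => [|d r y IHy].
  by rewrite free_mul0l !free_mul0r free_mul0l.
rewrite !(free_mulDl, free_mulDr) IHy; congr (_ + _).
rewrite !(free_mulZl, free_mulZr); congr (_ *: _).
elim/free_alg_ind: {IHy} z => [|e q z IHz].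
  by rewrite !free_mul0r.
rewrite !free_mulDr IHz; congr (_ + _); rewrite !free_mulZr; congr (_ *: _).
by rewrite !(free_mul_word, word_mullE) catA.
Qed.

Fact free_mul1l : left_id (word [::]) free_mul.
Proof.
move=> x; rewrite free_mul_word; elim/free_alg_ind: x => [|c s x IH].
  exact: raddf0.
by rewrite raddfD /= IH linearZ /= word_mullE.
Qed.

Fact free_mul1r : right_id (word [::]) free_mul.
Proof.
move=> x; elim/free_alg_ind: x => [|c s x IH]; first exact: free_mul0l.
by rewrite free_mulDl IH free_mulZl free_mul_word word_mullE cats0.
Qed.

Fact free_one_neq0 : word [::] != 0.
Proof.
apply/eqP => /(congr1 (flift (fun _ => 1 : K^o))) /eqP.
by rewrite flift_base raddf0 oner_eq0.
Qed.

HB.instance Definition _ := GRing.Zmodule_isNzRing.Build free_alg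
  free_mulA free_mul1l free_mul1r free_mulDl free_mulDr free_one_neq0.
HB.instance Definition _ := GRing.Lmodule_isLalgebra.Build K free_alg
  (fun c x y => esym (free_mulZl c x y)).
HB.instance Definition _ := GRing.Lalgebra_isAlgebra.Build K free_alg
  (fun c x y => esym (free_mulZr c x y)).

Lemma word_nil : word [::] = 1. Proof. by []. Qed.

Lemma word_cat s1 s2 : word (s1 ++ s2) = word s1 * word s2.
Proof. by rewrite -word_mullE -free_mul_word. Qed.

Lemma word_prod s : word s = \prod_(i <- s) gen i.
Proof.
elim: s => [|i s IH]; first by rewrite big_nil word_nil.
by rewrite big_cons -IH -word_cat.
Qed.

End FreeAlgebra.

(* The algebra homomorphism between free algebras with gen i |-> g i. *)
Section FreeSubst.
Variables (K : comNzRingType) (I J : choiceType) (g : I -> free_alg K J).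

Definition free_subst : free_alg K I -> free_alg K J :=
  flift (fun s => \prod_(i <- s) g i).
HB.instance Definition _ := GRing.Linear.on free_subst.

Lemma free_subst_word s : free_subst (word K s) = \prod_(i <- s) g i.
Proof. exact: flift_base. Qed.

Lemma free_subst_gen i : free_subst (gen K i) = g i.
Proof. by rewrite free_subst_word big_seq1. Qed.

Fact free_subst_is_monoid_morphism : monoid_morphism free_subst.
Proof.
split; first by rewrite -word_nil free_subst_word big_nil.
move=> x y; elim/free_alg_ind: x => [|c s x IH].
  by rewrite mul0r raddf0 mul0r.
rewrite mulrDl !raddfD /= mulrDl IH -scalerAl !linearZ /= -scalerAl.
congr (_ *: _ + _); elim/free_alg_ind: {IH} y => [|d r y IHy].
  by rewrite mulr0 raddf0 mulr0.
rewrite mulrDr !raddfD /= mulrDr IHy -scalerAr !linearZ /=.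
by rewrite -scalerAr -word_cat !free_subst_word big_cat.
Qed.
HB.instance Definition _ := GRing.isMonoidMorphism.Build
  (free_alg K I) (free_alg K J) free_subst free_subst_is_monoid_morphism.

End FreeSubst.

(* The algebra with generators [I] and relations [r = 0] for [rel r]. It may
   be the zero ring, hence only a [pzRingType] and not an [algType]. *)
Section PresentedAlgebra.
Variables (K : comNzRingType) (I : choiceType) (rel : free_alg K I -> Prop).
Notation F := (free_alg K I).

Definition ideal_closed (J : {pred F}) : Prop :=
  [/\ zmod_closed J, forall a x, x \in J -> a * x \in J
    & forall a x, x \in J -> x * a \in J].

Definition ideal_gen : {pred F} := fun x =>
  `[< forall J : {pred F}, ideal_closed J -> (forall r, rel r -> r \in J) ->
      x \in J >].

Lemma ideal_gen_closed : ideal_closed ideal_gen.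
Proof.
split; first split.
- by apply/asboolP => J [[J0 _] _ _] _.
- move=> x y /asboolP Hx /asboolP Hy; apply/asboolP => J JI JR.
  by case: (JI) => [[_ JB] _ _]; apply: JB; [apply: Hx | apply: Hy].
- move=> a x /asboolP Hx; apply/asboolP => J JI JR.
  by case: (JI) => [_ JM _]; apply: JM; apply: Hx.
- move=> a x /asboolP Hx; apply/asboolP => J JI JR.
  by case: (JI) => [_ _ JM]; apply: JM; apply: Hx.
Qed.

Lemma ideal_genMl a x : x \in ideal_gen -> a * x \in ideal_gen.
Proof. by case: ideal_gen_closed => _ + _; apply. Qed.

Lemma ideal_genMr a x : x \in ideal_gen -> x * a \in ideal_gen.
Proof. by case: ideal_gen_closed => _ _; apply. Qed.

Lemma ideal_gen_rel r : rel r -> r \in ideal_gen.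
Proof. by move=> rr; apply/asboolP => J _; apply. Qed.

Fact ideal_gen_zmod_closed : zmod_closed ideal_gen.
Proof. by case: ideal_gen_closed. Qed.
HB.instance Definition _ :=
  GRing.isZmodClosed.Build F ideal_gen ideal_gen_zmod_closed.

Definition presalg : Type := Quotient.quot ideal_gen.
HB.instance Definition _ := GRing.Zmodule.on presalg.
HB.instance Definition _ : EqQuotient F (Quotient.equiv ideal_gen) presalg :=
  EqQuotient.on presalg.

Definition ppi : F -> presalg :=
  locked_with free_key (fun x => \pi_presalg x).

Lemma ppiE x : ppi x = \pi_presalg x.
Proof. by rewrite /ppi unlock. Qed.
Definition pgen (i : I) : presalg := ppi (gen K i).

Lemma ppiK (x : presalg) : ppi (repr x) = x.
Proof. by rewrite ppiE reprK. Qed.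

Lemma eq_ppi x y : (ppi x = ppi y) <-> (x - y \in ideal_gen).
Proof. by rewrite 2!ppiE Quotient.idealrBE; split => [h|/eqP]; first exact/eqP. Qed.

Fact ppi_is_zmod_morphism : zmod_morphism ppi.
Proof. by move=> x y; rewrite !ppiE !piE. Qed.
HB.instance Definition _ :=
  GRing.isZmodMorphism.Build F presalg ppi ppi_is_zmod_morphism.

Lemma ppi_eq0 x : (ppi x = 0) <-> (x \in ideal_gen).
Proof. by rewrite -[0](raddf0 ppi) eq_ppi subr0. Qed.

Lemma repr_ppi x : repr (ppi x) - x \in ideal_gen.
Proof. by apply/eq_ppi; rewrite ppiK. Qed.

Definition pone : presalg := ppi 1.
Definition pmul : presalg -> presalg -> presalg :=
  locked_with free_key (fun x y => ppi (repr x * repr y)).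
Definition pscale : K -> presalg -> presalg :=
  locked_with free_key (fun c x => ppi (c *: repr x)).

Lemma pmulE x y : pmul (ppi x) (ppi y) = ppi (x * y).
Proof.
rewrite /pmul unlock.
apply/eq_ppi.
have -> : repr (ppi x) * repr (ppi y) - x * y =
    (repr (ppi x) - x) * repr (ppi y) + x * (repr (ppi y) - y).
  by rewrite mulrBl mulrBr addrA addrNK.
apply: rpredD.
Show.
  exact: (ideal_genMr _ (repr_ppi x)).
exact: (ideal_genMl _ (repr_ppi y)).
Qed.

Lemma pscaleE c x : pscale c (ppi x) = ppi (c *: x).
Proof.
rewrite /pscale unlock.
apply/eq_ppi; rewrite -scalerBr -[_ - x]mul1r scalerAl.
exact: (ideal_genMl _ (repr_ppi x)).
Qed.

Fact pmulA : associative pmul.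
Proof.
by move=> x y z; rewrite -(ppiK x) -(ppiK y) -(ppiK z) !pmulE mulrA.
Qed.
Fact pmul1 : left_id pone pmul.
Proof. by move=> x; rewrite -(ppiK x) pmulE mul1r. Qed.
Fact pmulr1 : right_id pone pmul.
Proof. by move=> x; rewrite -(ppiK x) pmulE mulr1. Qed.
Fact pmulDl : left_distributive pmul +%R.
Proof.
move=> x y z; rewrite -(ppiK x) -(ppiK y) -(ppiK z).
by rewrite -raddfD !pmulE mulrDl raddfD.
Qed.
Fact pmulDr : right_distributive pmul +%R.
Proof.
move=> x y z; rewrite -(ppiK x) -(ppiK y) -(ppiK z).
by rewrite -raddfD !pmulE mulrDr raddfD.
Qed.
HB.instance Definition _ := GRing.Zmodule_isPzRing.Build presalg
  pmulA pmul1 pmulr1 pmulDl pmulDr.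

Fact pscaleA a b x : pscale a (pscale b x) = pscale (a * b) x.
Proof. by rewrite -(ppiK x) !pscaleE scalerA. Qed.
Fact pscale1 : left_id 1 pscale.
Proof. by move=> x; rewrite -(ppiK x) pscaleE scale1r. Qed.
Fact pscaleDr : right_distributive pscale +%R.
Proof.
by move=> c x y; rewrite -(ppiK x) -(ppiK y) -raddfD !pscaleE scalerDr raddfD.
Qed.
Fact pscaleDl x : {morph pscale^~ x : a b / a + b}.
Proof. by move=> a b; rewrite -(ppiK x) !pscaleE scalerDl raddfD. Qed.
HB.instance Definition _ := GRing.Zmodule_isLmodule.Build K presalg
  pscaleA pscale1 pscaleDr pscaleDl.

Fact ppi_is_monoid_morphism : monoid_morphism ppi.
Proof. by split=> // x y; rewrite -pmulE. Qed.
HB.instance Definition _ :=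
  GRing.isMonoidMorphism.Build F presalg ppi ppi_is_monoid_morphism.
Fact ppi_is_scalable : scalable ppi.
Proof. by move=> c x; rewrite -pscaleE. Qed.
HB.instance Definition _ :=
  GRing.isScalable.Build K F presalg *:%R ppi ppi_is_scalable.

Lemma ppiM x y : ppi (x * y) = ppi x * ppi y. Proof. exact: rmorphM. Qed.
Lemma ppiZ c x : ppi (c *: x) = c *: ppi x. Proof. exact: linearZ. Qed.

Lemma pscalerAl (c : K) (x y : presalg) : c *: (x * y) = (c *: x) * y.
Proof. by rewrite -(ppiK x) -(ppiK y) -ppiM -!ppiZ -ppiM scalerAl. Qed.

Lemma pscalerAr (c : K) (x y : presalg) : c *: (x * y) = x * (c *: y).
Proof. by rewrite -(ppiK x) -(ppiK y) -ppiM -!ppiZ -ppiM scalerAr. Qed.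

Lemma ppi_rel r : rel r -> ppi r = 0.
Proof. by move=> rr; apply/ppi_eq0; apply: ideal_gen_rel. Qed.

Definition subalg_closed (S : {pred presalg}) : Prop :=
  GRing.subring_closed S /\ forall (c : K) x, x \in S -> c *: x \in S.

Definition subalg_gen (G : presalg -> Prop) : {pred presalg} := fun x =>
  `[< forall S : {pred presalg}, subalg_closed S -> (forall y, G y -> y \in S) ->
      x \in S >].

Lemma subalg_gen_closed G : subalg_closed (subalg_gen G).
Proof.
split; first split.
- by apply/asboolP => S [[S1 _ _] _] _.
- move=> x y /asboolP Hx /asboolP Hy; apply/asboolP => S SS SG.
  by case: (SS) => [[_ SB _] _]; apply: SB; [apply: Hx | apply: Hy].
- move=> x y /asboolP Hx /asboolP Hy; apply/asboolP => S SS SG.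
  by case: (SS) => [[_ _ SM] _]; apply: SM; [apply: Hx | apply: Hy].
- move=> c x /asboolP Hx; apply/asboolP => S SS SG.
  by case: (SS) => [_ SZ]; apply: SZ; apply: Hx.
Qed.

Lemma mem_subalg_gen (G : presalg -> Prop) x : G x -> x \in subalg_gen G.
Proof. by move=> Gx; apply/asboolP => S _; apply. Qed.

Fact subalg_gen_subring_closed G : GRing.subring_closed (subalg_gen G).
Proof. by case: (subalg_gen_closed G). Qed.
HB.instance Definition _ G := GRing.isSubringClosed.Build presalg (subalg_gen G)
  (subalg_gen_subring_closed G).

Lemma subalg_gen_scalar (G : presalg -> Prop) (c : K) :
  c *: (1 : presalg) \in subalg_gen G.
Proof. by case: (subalg_gen_closed G) => [[S1 _ _] SZ]; apply: SZ. Qed.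

Record subalg (G : presalg -> Prop) : Type :=
  Subalg { subalg_val :> presalg; subalg_valP : subalg_val \in subalg_gen G }.
HB.instance Definition _ G := [isSub for @subalg_val G].
HB.instance Definition _ G := [Choice of subalg G by <:].
HB.instance Definition _ G := GRing.SubChoice_isSubPzRing.Build presalg
  (subalg_gen G) (subalg G) (subalg_gen_subring_closed G).

End PresentedAlgebra.

(* The map between presented algebras with pgen i |-> ppi (g i); it does not
   depend on the choice of representatives, and is an algebra homomorphism, as
   soon as [free_subst g] sends the relations into the target ideal. *)
Section PresentedMap.
Variables (K : comNzRingType) (I J : choiceType).
Variables (rI : free_alg K I -> Prop) (rJ : free_alg K J -> Prop).
Variable g : I -> free_alg K J.

Definition presmap (x : presalg rI) : presalg rJ :=
  ppi rJ (free_subst g (repr x)).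

Hypothesis gP : forall r, rI r -> ppi rJ (free_subst g r) = 0.

Lemma presmapE x : presmap (ppi rI x) = ppi rJ (free_subst g x).
Proof.
suff ker y : y \in ideal_gen rI -> ppi rJ (free_subst g y) = 0.
  apply/eqP; rewrite -subr_eq0 -!raddfB /=; apply/eqP.
  by apply: ker; apply: repr_ppi.
move=> /asboolP /(_ (fun y => ppi rJ (free_subst g y) == 0)) H; apply/eqP; apply: H.
  split; first split.
  - by rewrite unfold_in !raddf0.
  - by move=> v w /eqP Hv /eqP Hw; rewrite unfold_in !raddfB /= Hv Hw subrr.
  - by move=> a v /eqP Hv; rewrite unfold_in rmorphM /= ppiM Hv mulr0.
  - by move=> a v /eqP Hv; rewrite unfold_in rmorphM /= ppiM Hv mul0r.
by move=> r rr; rewrite unfold_in gP.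
Qed.

Lemma presmap_gen i : presmap (pgen rI i) = ppi rJ (g i).
Proof. by rewrite presmapE free_subst_gen. Qed.

Lemma presmapD x y : presmap (x + y) = presmap x + presmap y.
Proof. by rewrite -(ppiK x) -(ppiK y) -raddfD !presmapE !raddfD. Qed.

Lemma presmapZ c x : presmap (c *: x) = c *: presmap x.
Proof. by rewrite -(ppiK x) -ppiZ !presmapE linearZ /= ppiZ. Qed.

Lemma presmap1 : presmap 1 = 1.
Proof. by rewrite -(rmorph1 (ppi rI)) presmapE !rmorph1. Qed.

Lemma presmapM x y : presmap (x * y) = presmap x * presmap y.
Proof. by rewrite -(ppiK x) -(ppiK y) -ppiM !presmapE rmorphM /= ppiM. Qed.

End PresentedMap.

(* The induced module H (x)_S V, for a ring homomorphism j : S -> H: the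
   quotient of the free abelian group on H * V by biadditivity and
   (h * j a) (x) v = h (x) (a *: v), with H acting on the left factor. *)
Section Induced.
Variables (H S : pzRingType) (j : {rmorphism S -> H}) (V : lmodType S).
Notation T := (free_mod int (H * V)%type).

Definition tbase (h : H) (v : V) : T := fbase int (h, v).

Inductive tensor_rel : T -> Prop :=
| tensor_rel_Dl h h' v :
    tensor_rel (tbase (h + h') v - (tbase h v + tbase h' v))
| tensor_rel_Dr h v v' :
    tensor_rel (tbase h (v + v') - (tbase h v + tbase h v'))
| tensor_rel_bal h a v : tensor_rel (tbase (h * j a) v - tbase h (a *: v)).

Definition tensor_ker : {pred T} := fun x =>
  `[< forall J : {pred T}, zmod_closed J -> (forall r, tensor_rel r -> r \in J) ->
      x \in J >].

Fact tensor_ker_zmod_closed : zmod_closed tensor_ker.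
Proof.
split; first by apply/asboolP => J [J0 _] _.
move=> x y /asboolP Hx /asboolP Hy; apply/asboolP => J JI JR.
by case: (JI) => _ JB; apply: JB; [apply: Hx | apply: Hy].
Qed.
HB.instance Definition _ :=
  GRing.isZmodClosed.Build T tensor_ker tensor_ker_zmod_closed.

Lemma tensor_ker_rel r : tensor_rel r -> r \in tensor_ker.
Proof. by move=> rr; apply/asboolP => J _; apply. Qed.

Definition induced : Type := Quotient.quot tensor_ker.
HB.instance Definition _ := GRing.Zmodule.on induced.
HB.instance Definition _ : EqQuotient T (Quotient.equiv tensor_ker) induced :=
  EqQuotient.on induced.

Definition tpi (x : T) : induced := \pi_induced x.

Lemma tpiK (x : induced) : tpi (repr x) = x.
Proof. exact: reprK. Qed.

Lemma eq_tpi x y : (tpi x = tpi y) <-> (x - y \in tensor_ker).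
Proof. by rewrite Quotient.idealrBE; split => [h|/eqP]; first exact/eqP. Qed.

Fact tpi_is_zmod_morphism : zmod_morphism tpi.
Proof. by move=> x y; rewrite /tpi !piE. Qed.
HB.instance Definition _ :=
  GRing.isZmodMorphism.Build T induced tpi tpi_is_zmod_morphism.

Lemma tpi_eq0 x : (tpi x = 0) <-> (x \in tensor_ker).
Proof. by rewrite -[0](raddf0 tpi) eq_tpi subr0. Qed.

Lemma tpi_Dl h h' v :
  tpi (tbase (h + h') v) = tpi (tbase h v) + tpi (tbase h' v).
Proof. by rewrite -raddfD; exact/eq_tpi/tensor_ker_rel/tensor_rel_Dl. Qed.

Definition tact (h : H) : T -> T := flift (fun p => tbase (h * p.1) p.2).
HB.instance Definition _ h := GRing.Linear.on (tact h).

Lemma tact_base h h' v : tact h (tbase h' v) = tbase (h * h') v.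
Proof. exact: flift_base. Qed.

Lemma tact_ker h x : x \in tensor_ker -> tact h x \in tensor_ker.
Proof.
move=> /asboolP /(_ (fun y => tact h y \in tensor_ker)); apply.
  split; first by rewrite unfold_in raddf0 rpred0.
  by move=> y z Hy Hz; rewrite unfold_in raddfB /=; apply: rpredB.
move=> r rr; rewrite unfold_in; apply: tensor_ker_rel.
case: rr => [h1 h2 v|h1 v1 v2|h1 a v]; rewrite (raddfB (tact h)) /=
  ?(raddfD (tact h)) /= !tact_base.
- by rewrite (mulrDr h h1 h2); exact: tensor_rel_Dl.
- exact: tensor_rel_Dr.
- by rewrite (mulrA h h1 (j a)); exact: tensor_rel_bal.
Qed.

Definition iscale (h : H) (x : induced) : induced := tpi (tact h (repr x)).

Lemma iscaleE h x : iscale h (tpi x) = tpi (tact h x).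
Proof.
apply/eq_tpi; rewrite -raddfB /=; apply: tact_ker.
by apply/eq_tpi; rewrite tpiK.
Qed.

Lemma induced_ind (P : induced -> Prop) :
  P 0 -> (forall (c : int) h v x, P x -> P (tpi (tbase h v) *~ c + x)) ->
  forall x, P x.
Proof.
move=> P0 PD x; rewrite -(tpiK x); elim/free_mod_ind: (repr x) => [|c [h v] y IH].
  by rewrite raddf0.
by rewrite raddfD /= -(intz c) scaler_int raddfMz; apply: PD.
Qed.

Fact iscaleDr : right_distributive iscale +%R.
Proof.
by move=> h x y; rewrite -(tpiK x) -(tpiK y) -raddfD !iscaleE !raddfD.
Qed.

Fact iscaleMz h x c : iscale h (x *~ c) = iscale h x *~ c.
Proof. by rewrite -(tpiK x) -raddfMz !iscaleE !raddfMz. Qed.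

Fact iscale0r h : iscale h 0 = 0.
Proof. by rewrite -[0](raddf0 tpi) iscaleE !raddf0. Qed.

Fact iscaleA a b x : iscale a (iscale b x) = iscale (a * b) x.
Proof.
elim/induced_ind: x => [|c h v x IH]; first by rewrite !iscale0r.
by rewrite !(iscaleDr, iscaleMz) IH !iscaleE !tact_base mulrA.
Qed.

Fact iscale1 : left_id 1 iscale.
Proof.
move=> x; elim/induced_ind: x => [|c h v x IH]; first by rewrite iscale0r.
by rewrite iscaleDr iscaleMz IH iscaleE tact_base mul1r.
Qed.

Fact iscaleDl x : {morph iscale^~ x : a b / a + b}.
Proof.
move=> a b /=; elim/induced_ind: x => [|c h v x IH].
  by rewrite !iscale0r addr0.
rewrite !(iscaleDr, iscaleMz) IH addrACA -mulrzDl !iscaleE !tact_base.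
by rewrite (mulrDl a b h) tpi_Dl.
Qed.

HB.instance Definition _ := GRing.Zmodule_isLmodule.Build H induced
  iscaleA iscale1 iscaleDr iscaleDl.

Definition tens (h : H) (v : V) : induced := tpi (tbase h v).

Lemma tensDl h h' v : tens (h + h') v = tens h v + tens h' v.
Proof. exact: tpi_Dl. Qed.

Lemma tensDr h v v' : tens h (v + v') = tens h v + tens h v'.
Proof. by rewrite -raddfD; exact/eq_tpi/tensor_ker_rel/tensor_rel_Dr. Qed.

Lemma tens_bal h a v : tens (h * j a) v = tens h (a *: v).
Proof. exact/eq_tpi/tensor_ker_rel/tensor_rel_bal. Qed.

Lemma scale_tens h h' v : h *: tens h' v = tens (h * h') v.
Proof. by rewrite [LHS]iscaleE tact_base. Qed.

End Induced.

(* Even signed permutations: (i, false) stands for i and (i, true) for -i.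
   In [perm] the product s * t applies s first. *)
Section TypeD.
Variable n : nat.
Notation signed := ('I_n * bool)%type.

Definition sneg (x : signed) : signed := (x.1, ~~ x.2).

Definition WD : {set {perm signed}} :=
  [set s : {perm signed} | [forall x, s (sneg x) == sneg (s x)] &&
     ~~ odd #|[set i | (s (i, false)).2]|].

Lemma odd_negE (s : {perm signed}) :
  odd #|[set i | (s (i, false)).2]| = \big[addb/false]_i (s (i, false)).2.
Proof.
rewrite -sum1_card (big_morph odd oddD (erefl _)) big_mkcond.
by apply: eq_bigr => i _; rewrite inE; case: (s _).2.
Qed.

Lemma WDP (s : {perm signed}) :
  reflect ((forall i b, s (i, b) = ((s (i, false)).1, b (+) (s (i, false)).2)) /\
           \big[addb/false]_i (s (i, false)).2 = false) (s \in WD).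
Proof.
rewrite inE odd_negE; apply: (iffP andP) => [[/forallP H /negbTE->]|[H ->]].
  split=> // i [|]; last by rewrite addFb -surjective_pairing.
  exact: eqP (H (i, false)).
split=> //; apply/forallP => -[i b]; apply/eqP.
by rewrite /sneg /= H (H i b) /= addNb.
Qed.

Fact WD_group_set : group_set WD.
Proof.
apply/group_setP; split.
  apply/WDP; split=> [i b|]; first by rewrite !perm1 addbF.
  by apply: big1 => i _; rewrite perm1.
move=> s t /WDP[Hs es] /WDP[Ht et]; apply/WDP; split.
  move=> i b; rewrite !permM (Hs i b); case: (s (i, false)) => l c /=.
  by rewrite (Ht l (b (+) c)) (Ht l c) /= addbA.
pose f i := (s (i, false)).1.
have f_inj : injective f.
  move=> i k fik; suff [] : (i, false) = (k, (s (i, false)).2 (+) (s (k, false)).2).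
    by [].
  apply: (@perm_inj _ s); rewrite (Hs k (_ (+) _)) -addbA addbb addbF -/(f k) -fik.
  by rewrite -surjective_pairing.
rewrite (eq_bigr (fun i => (s (i, false)).2 (+) (t (f i, false)).2)).
  by rewrite big_split /= es -[RHS]et [RHS](reindex_inj f_inj).
by move=> i _; rewrite permM [s _]surjective_pairing Ht.
Qed.
Canonical WD_group := Group WD_group_set.

(* The image of an index under the unsigned permutation sigma^*. *)
Definition wstar (s : {perm signed}) (i : 'I_n) : 'I_n := (s (i, false)).1.

Definition refl_fun (i k : 'I_n) (x : signed) : signed := (tperm i k x.1, x.2).
Definition nrefl_fun (i k : 'I_n) (x : signed) : signed :=
  (tperm i k x.1, x.2 (+) ((x.1 == i) (+) (x.1 == k))).

Fact refl_funK i k : involutive (refl_fun i k).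
Proof. by case=> l b; rewrite /refl_fun /= tpermK. Qed.
Fact nrefl_funK i k : involutive (nrefl_fun i k).
Proof.
case=> l b; rewrite /nrefl_fun /= tpermK -addbA; congr (_, _).
case: tpermP => [->|->|/eqP/negbTE-> /eqP/negbTE->]; rewrite ?eqxx.
- by rewrite [k == i]eq_sym; case: (i == k); case: b.
- by rewrite [k == i]eq_sym; case: (i == k); case: b.
- by case: b.
Qed.

Definition refl_perm i k : {perm signed} := perm (can_inj (refl_funK i k)).
Definition nrefl_perm i k : {perm signed} := perm (can_inj (nrefl_funK i k)).

Fact refl_WD i k : refl_perm i k \in WD.
Proof.
apply/WDP; split=> [l b|]; first by rewrite !permE /refl_fun /= addbF.
by apply: big1 => l _; rewrite permE.
Qed.

Fact nrefl_WD i k : nrefl_perm i k \in WD.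
Proof.
apply/WDP; split=> [l b|]; first by rewrite !permE.
under eq_bigr do rewrite permE /=.
rewrite big_split /= (bigD1 i) //= eqxx big1 => [|l /negbTE->] //.
by rewrite (bigD1 k) //= eqxx big1 => [|l /negbTE->].
Qed.

Definition s_ (i k : 'I_n) : [subg WD] := Subg (refl_WD i k).
(* Meant for i != k: the two sign changes cancel when i = k. *)
Definition sbar (i k : 'I_n) : [subg WD] := Subg (nrefl_WD i k).

End TypeD.

Section SkewPolynomials.
Variables (K : comNzRingType) (n : nat).

Inductive skew_rel : free_alg K 'I_n -> Prop :=
| skew_rel_xi i j : i != j ->
    skew_rel (gen K i * gen K j + gen K j * gen K i).

Definition skew_poly := presalg skew_rel.
HB.instance Definition _ := GRing.PzRing.on skew_poly.
HB.instance Definition _ := GRing.Lmodule.on skew_poly.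

Definition sx (i : 'I_n) : skew_poly := pgen skew_rel i.

Definition perm_fun (i k j : 'I_n) : free_alg K 'I_n := gen K (tperm i k j).
Definition sign_fun (i j : 'I_n) : free_alg K 'I_n :=
  if j == i then - gen K j else gen K j.

Definition swap (i k : 'I_n) (f : skew_poly) : skew_poly :=
  presmap skew_rel (perm_fun i k) f.
Definition tau (i : 'I_n) (f : skew_poly) : skew_poly :=
  presmap skew_rel (sign_fun i) f.

Definition word_partial (i : 'I_n) (s : seq 'I_n) : free_alg K 'I_n :=
  \sum_(k < size s | tnth (in_tuple s) k == i)
    (-1) ^+ k *: (word K (take k s) * word K (drop k.+1 s)).

Definition free_partial (i : 'I_n) : free_alg K 'I_n -> free_alg K 'I_n :=
  flift (word_partial i).
HB.instance Definition _ i := GRing.Linear.on (free_partial i).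

(* Independent of the representative, see [partialE]. *)
Definition partial (i : 'I_n) (f : skew_poly) : skew_poly :=
  ppi skew_rel (free_partial i (repr f)).

Definition dunkl_num (i k : 'I_n) (f : skew_poly) : skew_poly :=
  (sx i - sx k) * swap i k f - (sx i * tau i f - sx k * tau k f).

(* The quotient of f by d, meaningful when there is exactly one. *)
Definition skew_div (d f : skew_poly) : skew_poly :=
  xget 0 [set g : skew_poly | d * g = f]%classic.

Definition dunkl (t u : K) (i : 'I_n) (f : skew_poly) : skew_poly :=
  t *: partial i f
  + u *: \sum_(k < n | k != i)
           2%:R *: skew_div (sx i ^+ 2 - sx k ^+ 2) (dunkl_num i k f).

Lemma sxC i j : i != j -> sx i * sx j = - (sx j * sx i).
Proof.
move=> /skew_rel_xi/ppi_rel; rewrite raddfD /= 2!ppiM => /eqP.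
by rewrite addr_eq0 => /eqP.
Qed.

Lemma skew_ppi_C i j : i != j ->
  ppi skew_rel (gen K i * gen K j) = - ppi skew_rel (gen K j * gen K i).
Proof. by move=> ij; rewrite 2!ppiM sxC. Qed.

Lemma perm_funP i k r : skew_rel r -> ppi skew_rel (free_subst (perm_fun i k) r) = 0.
Proof.
case=> a b ab; rewrite raddfD /= 2!rmorphM /= 2!free_subst_gen.
by apply/ppi_rel/skew_rel_xi; rewrite (inj_eq perm_inj).
Qed.

Lemma sign_funP i r : skew_rel r -> ppi skew_rel (free_subst (sign_fun i) r) = 0.
Proof.
case=> a b ab; rewrite raddfD /= 2!rmorphM /= 2!free_subst_gen raddfD /= /sign_fun.
by case: (a == i); case: (b == i); rewrite ?mulrNN ?mulNr ?mulrN ?raddfN /=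
  (skew_ppi_C ab) ?opprK ?subrr ?addNr.
Qed.

Lemma swap_sx i k j : swap i k (sx j) = sx (tperm i k j).
Proof. by rewrite /swap presmap_gen //; apply: perm_funP. Qed.
Lemma swapD i k f g : swap i k (f + g) = swap i k f + swap i k g.
Proof. by apply: presmapD; apply: perm_funP. Qed.
Lemma swapZ i k c f : swap i k (c *: f) = c *: swap i k f.
Proof. by apply: presmapZ; apply: perm_funP. Qed.
Lemma swap1 i k : swap i k 1 = 1.
Proof. by apply: presmap1; apply: perm_funP. Qed.
Lemma swapM i k f g : swap i k (f * g) = swap i k f * swap i k g.
Proof. by apply: presmapM; apply: perm_funP. Qed.

Lemma tau_sx i j : tau i (sx j) = if j == i then - sx j else sx j.
Proof.
rewrite /tau presmap_gen; last exact: sign_funP.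
by rewrite /sign_fun; case: eqP; rewrite ?raddfN.
Qed.
Lemma tauD i f g : tau i (f + g) = tau i f + tau i g.
Proof. by apply: presmapD; apply: sign_funP. Qed.
Lemma tauZ i c f : tau i (c *: f) = c *: tau i f.
Proof. by apply: presmapZ; apply: sign_funP. Qed.
Lemma tau1 i : tau i 1 = 1.
Proof. by apply: presmap1; apply: sign_funP. Qed.
Lemma tauM i f g : tau i (f * g) = tau i f * tau i g.
Proof. by apply: presmapM; apply: sign_funP. Qed.

Lemma free_partial_word i s : free_partial i (word K s) = word_partial i s.
Proof. exact: flift_base. Qed.

Lemma word_partial_cons i j s : word_partial i (j :: s) =
  (if j == i then word K s else 0) - gen K j * word_partial i s.
Proof.
rewrite /word_partial big_mkcond big_ord_recl /= drop0 expr0 scale1r mul1r.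
congr (_ + _); rewrite mulr_sumr -sumrN [RHS]big_mkcond; apply: eq_bigr => k _.
rewrite !(tnth_nth j) /=; case: ifP => // _.
by rewrite exprS mulN1r scaleNr -scalerAr [in RHS]mulrA -!word_cat.
Qed.

Local Notation alpha := (free_subst (fun j : 'I_n => - gen K j)).

Lemma free_partial_genM i j y :
  free_partial i (gen K j * y) =
  (if j == i then y else 0) - gen K j * free_partial i y.
Proof.
elim/free_alg_ind: y => [|c s y IH].
  by rewrite !(mulr0, raddf0) /= addr0 if_same.
rewrite mulrDr !raddfD /= mulrDr IH opprD -scalerAr !linearZ /= -scalerAr.
rewrite -(word_cat _ [:: j] s) free_partial_word word_partial_cons free_partial_word.
rewrite scalerBr addrACA; congr (_ + _).
by case: (j == i); rewrite // scaler0 addr0.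
Qed.

Lemma free_partialM i x y :
  free_partial i (x * y) = free_partial i x * y + alpha x * free_partial i y.
Proof.
elim/free_alg_ind: x => [|c s x IH]; first by rewrite !(mul0r, raddf0) /= addr0.
rewrite mulrDl !raddfD /= !mulrDl IH addrACA; congr (_ + _).
rewrite -scalerAl !linearZ /= -!scalerAl -scalerDr; congr (_ *: _).
elim: s {IH x} => [|j s IHs].
  rewrite word_nil rmorph1 !mul1r -word_nil free_partial_word /word_partial big_ord0.
  by rewrite mul0r add0r.
rewrite (word_cat _ [:: j] s) -mulrA !free_partial_genM IHs rmorphM /=.
rewrite free_subst_gen mulrDr opprD addrA mulrBl !mulNr !mulrA; congr (_ - _ - _).
by case: (j == i); rewrite // mul0r.
Qed.

Lemma partialE i x :
  partial i (ppi skew_rel x) = ppi skew_rel (free_partial i x).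
Proof.
apply/eq_ppi; rewrite -raddfB /=.
pose J := ideal_gen skew_rel.
pose P y := [&& y \in J, free_partial i y \in J & alpha y \in J].
suff JP y : y \in J -> P y by have /JP/and3P[] := repr_ppi skew_rel x.
move=> /asboolP /(_ P); apply.
  split; first split.
  - by rewrite unfold_in /P !raddf0 /= !rpred0.
  - move=> v w /and3P[v1 v2 v3] /and3P[w1 w2 w3].
    by rewrite unfold_in /P !raddfB /= !rpredB.
  - move=> a v /and3P[v1 v2 v3]; rewrite unfold_in /P free_partialM rmorphM /=.
    by rewrite (ideal_genMl _ v1) (ideal_genMl _ v3) rpredD ?ideal_genMl.
  - move=> a v /and3P[v1 v2 v3]; rewrite unfold_in /P free_partialM rmorphM /=.
    by rewrite (ideal_genMr _ v1) (ideal_genMr _ v3) rpredD ?ideal_genMr.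
move=> r rr; have rJ := ideal_gen_rel rr; apply/and3P; split=> //; case: rr rJ.
  move=> a b ab _; rewrite raddfD /= !free_partial_genM.
  rewrite !(free_partial_word _ [:: _]) !word_partial_cons.
  have -> : word_partial i [::] = 0 by rewrite /word_partial big_ord0.
  rewrite !mulr0 !subr0 word_nil.
  by case: (a == i); case: (b == i);
    rewrite !(mulr0, mulr1, subr0, sub0r, addrA, addrNK, addNr, subrr, oppr0) rpred0.
move=> a b _; rewrite raddfD /= !rmorphM /= !free_subst_gen.
by rewrite !mulrNN.
Qed.

Lemma partial_word i s :
  partial i (\prod_(j <- s) sx j) =
  \sum_(k < size s | tnth (in_tuple s) k == i)
    (-1) ^+ k *: ((\prod_(j <- take k s) sx j) * \prod_(j <- drop k.+1 s) sx j).
Proof.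
have E r : \prod_(j <- r) sx j = ppi skew_rel (word K r).
  by rewrite word_prod rmorph_prod.
rewrite E partialE free_partial_word raddf_sum; apply: eq_bigr => k _.
by rewrite /= ppiZ ppiM !E.
Qed.

End SkewPolynomials.

Section OddDAHA.
Variables (K : comNzRingType) (n : nat) (t u : K).

Definition daha_gen : Type := ('I_n + 'I_n + [subg WD n])%type.
HB.instance Definition _ := Finite.on daha_gen.
Notation F := (free_alg K daha_gen).

Definition gxi (i : 'I_n) : F := gen K (inl (inl i) : daha_gen).
Definition geta (i : 'I_n) : F := gen K (inl (inr i) : daha_gen).
Definition gw (s : [subg WD n]) : F := gen K (inr s : daha_gen).

(* In [daha_mul], (r * s)%g is the composite "r first, then s", that is, the
   product sr of W. *)
Inductive daha_rel : F -> Prop :=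
| daha_one : daha_rel (gw 1%g - 1)
| daha_mul (s r : [subg WD n]) : daha_rel (gw (r * s)%g - gw s * gw r)
| daha_eta i j : i != j -> daha_rel (geta i * geta j + geta j * geta i)
| daha_xi i j : i != j -> daha_rel (gxi i * gxi j + gxi j * gxi i)
| daha_w_xi s j : daha_rel (gw s * gxi j - gxi (wstar (val s) j) * gw s)
| daha_w_eta s j : daha_rel (gw s * geta j - geta (wstar (val s) j) * gw s)
| daha_eta_xi i j : i != j ->
    daha_rel (geta i * gxi j + gxi j * geta i
              - u *: (gw (s_ i j) + gw (sbar i j)))
| daha_eta_xi_diag i :
    daha_rel (geta i * gxi i + gxi i * geta i
              - (t%:A + u *: \sum_(k < n | k != i) (gw (s_ k i) + gw (sbar k i)))).

Definition daha := presalg daha_rel.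
HB.instance Definition _ := GRing.PzRing.on daha.
HB.instance Definition _ := GRing.Lmodule.on daha.

Definition xi (i : 'I_n) : daha := ppi daha_rel (gxi i).
Definition eta (i : 'I_n) : daha := ppi daha_rel (geta i).
Definition wgt (s : [subg WD n]) : daha := ppi daha_rel (gw s).

Inductive heta_gens : daha -> Prop :=
| heta_gens_eta i : heta_gens (eta i)
| heta_gens_w s : heta_gens (wgt s).

Definition heta := subalg heta_gens.
HB.instance Definition _ := GRing.PzRing.on heta.

Definition heta_incl : heta -> daha := @subalg_val _ _ _ _.
Fact heta_incl_is_zmod_morphism : zmod_morphism heta_incl.
Proof. exact: (raddfB (val : heta -> daha)). Qed.
Fact heta_incl_is_monoid_morphism : monoid_morphism heta_incl.
Proof.
by split; [exact: (rmorph1 (val : heta -> daha))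
          | exact: (rmorphM (val : heta -> daha))].
Qed.
HB.instance Definition _ := GRing.isZmodMorphism.Build heta daha heta_incl
  heta_incl_is_zmod_morphism.
HB.instance Definition _ := GRing.isMonoidMorphism.Build heta daha heta_incl
  heta_incl_is_monoid_morphism.

Definition eta_h (i : 'I_n) : heta := Subalg (mem_subalg_gen (heta_gens_eta i)).
Definition w_h (s : [subg WD n]) : heta := Subalg (mem_subalg_gen (heta_gens_w s)).
Definition scalar_h (c : K) : heta := Subalg (subalg_gen_scalar heta_gens c).

(* V is one-dimensional over K with basis v0, trivial as a W-module, and
   killed by each eta_i. *)
Definition is_trivial_module (V : lmodType heta) (v0 : V) : Prop :=
  [/\ v0 <> 0,
      forall v, exists c, v = scalar_h c *: v0,
      forall s (v : V), w_h s *: v = v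
    & forall i (v : V), eta_h i *: v = 0].

Definition ind_heta (V : lmodType heta) := induced heta_incl V.
HB.instance Definition _ V := GRing.Lmodule.on (ind_heta V).

Definition skew_incl (f : skew_poly K n) : daha := presmap daha_rel gxi f.

Lemma skew_inclP r : skew_rel r -> ppi daha_rel (free_subst gxi r) = 0.
Proof.
case=> i j ij; rewrite raddfD /= 2!rmorphM /= 2!free_subst_gen.
exact/ppi_rel/daha_xi.
Qed.

Lemma skew_incl_sx i : skew_incl (sx K i) = xi i.
Proof. exact: (presmap_gen skew_inclP). Qed.
Lemma skew_inclD f g : skew_incl (f + g) = skew_incl f + skew_incl g.
Proof. exact: (presmapD skew_inclP). Qed.
Lemma skew_inclZ c f : skew_incl (c *: f) = c *: skew_incl f.
Proof. exact: (presmapZ skew_inclP). Qed.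
Lemma skew_incl1 : skew_incl 1 = 1.
Proof. exact: (presmap1 skew_inclP). Qed.
Lemma skew_inclM f g : skew_incl (f * g) = skew_incl f * skew_incl g.
Proof. exact: (presmapM skew_inclP). Qed.

(* The identification of the skew polynomials with the induced module. *)
Definition skew_ind (V : lmodType heta) (v0 : V) (f : skew_poly K n) : ind_heta V :=
  tens heta_incl (skew_incl f) v0.

End OddDAHA.

(* Main.v *)
From HB Require Import structures.
Require Import Defs.
From mathcomp Require Import all_boot all_algebra all_fingroup.
From mathcomp Require Import generic_quotient boolp classical_sets reals complex.
From mathcomp Require Import ssrcomplements mpoly.

Set Implicit Arguments.
Unset Strict Implicit.
Unset Printing Implicit Defensive.

Import GRing.Theory.
Local Open Scope ring_scope.

(** Write [D i] for the Dunkl operators and [A] for the skew polynomials. A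
linear operator on [A] is determined by its value at [1] together with a rule
that moves it past each generator, so every identity below is an induction on
words. For [D i] these data are [D i 1 = 0] and the rule [dunkl_sx],

  D i (x_j f) = - x_j (D i f) + R_ij f,

where [R_ij] is the operator [anticomm i j] by which the relations of the
algebra want [eta_i xi_j + xi_j eta_i] to act: [2 u s_ij] for [j <> i], and
[t + 2 u sum_k s_ik] for [j = i]. The factor 2 arises because a reflection and
its signed companion act on [A] in the same way. On the induced module,
[eta_i] kills the generator and obeys the same rule by the defining relations,
hence [eta_i] and [D i] correspond to each other ([skew_ind_eta]). This much
also shows that the skew polynomials span the induced module.

Two points remain. First, the division in [D i] is well defined. A quotient
exists because the numerator satisfies a recursion of the above kind
([dunkl_num_left], [dunkl_num_right], [dunkl_num_other]). It is unique because
[x_i^2 - x_k^2] is not a zero divisor ([sx_sqB_inj]): ordered monomials are a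
basis of [A], and in this basis multiplication by [x_i^2] is multiplication by
the square of a variable in a commutative polynomial ring.

Secondly, the skew polynomials are independent in the induced module. For that
[A] itself has to be a module over the whole algebra, with [eta_i] acting by
[D i], and the relation that is not immediate is [D i (D j f) + D j (D i f) = 0]
([dunkl_anti]). By [dunkl_sx] this operator commutes with every [x_k] as soon as

  D_i R_jk + D_j R_ik = R_ik D_j + R_jk D_i,

which follows from the equivariance of the Dunkl operators under permutations
of the indices; since it kills [1], it is zero. Once [A] is a module, the
subalgebra generated by the [eta_i] and the group acts on the line through [1]
by a character [chi]. This character gives the one-dimensional module, and
[h (x) v |-> h . (v 1)] is the inverse of the identification of [A] with the
induced module ([skew_ind_bij]). *)

(** * Modules over presented algebras *)

Section PresentedAlgebraAction.
Variables (K : comNzRingType) (I : choiceType) (rel : free_alg K I -> Prop).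

(** In this form a claim about a presented algebra needs to be checked on
multiplication by one generator at a time. *)
Lemma pres_ind (P : presalg rel -> Prop) :
  P 0 -> P 1 -> (forall c x y, P x -> P y -> P (c *: x + y)) ->
  (forall i x, P x -> P (pgen rel i * x)) -> forall x, P x.
Proof.
move=> P0 P1 PD PM x; rewrite -(ppiK x).
elim/free_alg_ind: (repr x) => [|c s y IH]; first by rewrite raddf0.
rewrite raddfD /= ppiZ; apply: PD => //; elim: s {IH} => [|i s IHs].
  by rewrite word_nil rmorph1.
by rewrite (word_cat _ [:: i] s) ppiM; apply: PM.
Qed.

Lemma ppi_eq x y : rel (x - y) -> ppi rel x = ppi rel y.
Proof. by move=> /ppi_rel; rewrite raddfB => /eqP; rewrite subr_eq0 => /eqP. Qed.

Variables (M : lmodType K) (op : I -> {linear M -> M}).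

(** The generators act by the operators [op]; a word acts by their composite,
its last letter first. *)
Definition free_act (x : free_alg K I) (m : M) : M :=
  flift (fun s => foldr op m s) x.

Lemma free_act_word s m : free_act (word K s) m = foldr op m s.
Proof. exact: flift_base. Qed.

Lemma free_actDl x y m : free_act (x + y) m = free_act x m + free_act y m.
Proof. by rewrite /free_act raddfD. Qed.

Lemma free_actZl c x m : free_act (c *: x) m = c *: free_act x m.
Proof. by rewrite /free_act linearZ. Qed.

Lemma free_act0l m : free_act 0 m = 0.
Proof. by rewrite /free_act raddf0. Qed.

Lemma free_actNl x m : free_act (- x) m = - free_act x m.
Proof. by rewrite -[- x]scaleN1r free_actZl scaleN1r. Qed.

Fact free_act_is_linear x : linear (free_act x).
Proof.
move=> c m m'; elim/free_alg_ind: x => [|d s x IH].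
  by rewrite !free_act0l scaler0 addr0.
rewrite !free_actDl. rewrite !free_actZl IH !free_act_word.
have -> : foldr op (c *: m + m') s = c *: foldr op m s + foldr op m' s.
  by elim: s => //= i s ->; rewrite linearP.
by rewrite !scalerDr !scalerA mulrC addrACA.
Qed.
HB.instance Definition _ x :=
  GRing.isLinear.Build K M M *:%R (free_act x) (free_act_is_linear x).

Lemma free_actM x y m : free_act (x * y) m = free_act x (free_act y m).
Proof.
elim/free_alg_ind: x => [|c s x IH]; first by rewrite mul0r !free_act0l.
rewrite mulrDl !free_actDl IH -scalerAl !free_actZl; congr (_ *: _ + _).
elim/free_alg_ind: {IH} y => [|d r y IH].
  by rewrite mulr0 !free_act0l linear0.
rewrite mulrDr !free_actDl IH linearD /= -scalerAr !free_actZl linearZ /=.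
by rewrite -word_cat !free_act_word foldr_cat.
Qed.

Lemma free_act_gen i m : free_act (gen K i) m = op i m.
Proof. exact: free_act_word. Qed.

Lemma free_act1 m : free_act 1 m = m.
Proof. by rewrite -word_nil free_act_word. Qed.

Lemma free_act_sum (J : finType) (P : pred J) (F : J -> free_alg K I) m :
  free_act (\sum_(j | P j) F j) m = \sum_(j | P j) free_act (F j) m.
Proof.
by apply: (big_morph (free_act ^~ m)) => [x y|];
  rewrite ?free_actDl ?free_act0l.
Qed.

Definition pres_act (h : presalg rel) (m : M) : M := free_act (repr h) m.
HB.instance Definition _ h := GRing.isLinear.Build K M M *:%R (pres_act h)
  (free_act_is_linear (repr h)).

Hypothesis relP : forall r, rel r -> forall m, free_act r m = 0.

(** The elements that act by zero form a two-sided ideal; it contains the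
relations, hence the ideal that they generate. *)
Lemma pres_actE x m : pres_act (ppi rel x) m = free_act x m.
Proof.
apply/eqP; rewrite -subr_eq0 -free_actNl -free_actDl; apply/eqP.
suff H y : y \in ideal_gen rel -> forall m, free_act y m = 0.
  exact/H/repr_ppi.
move=> /asboolP /(_ (fun y => `[< forall m, free_act y m = 0 >])) H.
apply/asboolP; apply: H => [|r /relP rr]; last exact/asboolP.
split; first split.
- by apply/asboolP => m'; rewrite free_act0l.
- move=> a b /asboolP Ha /asboolP Hb; apply/asboolP => m'.
  by rewrite free_actDl free_actNl Ha Hb subr0.
- by move=> a b /asboolP Hb; apply/asboolP => m'; rewrite free_actM Hb linear0.
- by move=> a b /asboolP Hb; apply/asboolP => m'; rewrite free_actM Hb.
Qed.

Lemma pres_act_gen i m : pres_act (pgen rel i) m = op i m.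
Proof. by rewrite pres_actE free_act_gen. Qed.

Lemma pres_act1 m : pres_act 1 m = m.
Proof. by rewrite -(rmorph1 (ppi rel)) pres_actE free_act1. Qed.

Lemma pres_actM x y m : pres_act (x * y) m = pres_act x (pres_act y m).
Proof. by rewrite -(ppiK x) -(ppiK y) -ppiM !pres_actE free_actM. Qed.

Lemma pres_actDl x y m : pres_act (x + y) m = pres_act x m + pres_act y m.
Proof. by rewrite -(ppiK x) -(ppiK y) -raddfD !pres_actE free_actDl. Qed.

Lemma pres_actZl c x m : pres_act (c *: x) m = c *: pres_act x m.
Proof. by rewrite -(ppiK x) -ppiZ !pres_actE free_actZl. Qed.
End PresentedAlgebraAction.

(** * Ordered monomials in the skew polynomials *)

Section MonomialLift.
Variables (K : comNzRingType) (n : nat) (M : lmodType K) (g : 'X_{1..n} -> M).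

Definition monomial_lift (p : {mpoly K[n]}) : M := \sum_(m <- msupp p) p@_m *: g m.

Lemma monomial_liftEw (p : {mpoly K[n]}) b : (msize p <= b)%N ->
  monomial_lift p = \sum_(m : 'X_{1..n < b}) p@_m *: g m.
Proof.
move=> le_pb; pose I : subFinType _ := 'X_{1..n < b}.
rewrite /monomial_lift (big_mksub I) ?msupp_uniq //=; last first.
  by move=> m /msize_mdeg_lt /leq_trans; apply.
by rewrite big_rmcond //= => m /memN_msupp_eq0 ->; rewrite scale0r.
Qed.

Fact monomial_lift_is_linear : linear monomial_lift.
Proof.
move=> c p q; pose b := maxn (msize (c *: p + q)) (maxn (msize p) (msize q)).
rewrite (@monomial_liftEw (c *: p + q) b) ?leq_maxl //.
rewrite (@monomial_liftEw p b) ?(@monomial_liftEw q b) ?leq_max ?leqnn ?orbT //.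
rewrite scaler_sumr -big_split; apply: eq_bigr => m _ /=.
by rewrite mcoeffD mcoeffZ scalerDl scalerA.
Qed.
HB.instance Definition _ :=
  GRing.isLinear.Build K {mpoly K[n]} M *:%R monomial_lift monomial_lift_is_linear.

Lemma monomial_liftX m : monomial_lift 'X_[m] = g m.
Proof. by rewrite /monomial_lift msuppX big_seq1 mcoeffX eqxx scale1r. Qed.
End MonomialLift.

Section SkewBasis.
Variables (K : comNzRingType) (n : nat).
Notation A := (skew_poly K n).
Implicit Types (i j k : 'I_n) (m : 'X_{1..n}) (f g : A).

Lemma skew_poly_ind (P : A -> Prop) :
  P 0 -> P 1 -> (forall c f g, P f -> P g -> P (c *: f + g)) ->
  (forall i f, P f -> P (sx K i * f)) -> forall f, P f.
Proof. exact: pres_ind. Qed.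

(** The number of variables that [x_i] passes on its way to its own place in
the ordered monomial of exponent [m]. *)
Definition jumps i m : nat := \sum_(j < n | (j < i)%N) m j.

Lemma jumpsU i j m : jumps i (m + U_(j))%MM = (jumps i m + (j < i))%N.
Proof.
rewrite /jumps (eq_bigr (fun l => m l + (j == l)))%N; last first.
  by move=> l _; rewrite mnmDE mnm1E.
rewrite big_split /=; congr (_ + _)%N.
case: ltnP => ji; last first.
  by rewrite big1 // => l li; case: eqP => // jl; rewrite -jl ltnNge ji in li.
rewrite (bigD1 j) //= eqxx big1 ?addn0 // => l /andP[_ lj].
by rewrite eq_sym (negbTE lj).
Qed.

(** Left multiplication by [x_i], written in the basis of ordered monomials. *)
Definition xmul i : {linear {mpoly K[n]} -> {mpoly K[n]}} :=
  monomial_lift (fun m => (-1) ^+ jumps i m *: 'X_[m + U_(i)]).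

Lemma xmulX i m : xmul i 'X_[m] = (-1) ^+ jumps i m *: 'X_[m + U_(i)].
Proof. exact: monomial_liftX. Qed.

Lemma xmul_anti i j p : i != j -> xmul i (xmul j p) + xmul j (xmul i p) = 0.
Proof.
move=> ij; elim/mpolyind: p => [|c m p _ _ IH]; first by rewrite !linear0 addr0.
rewrite !linearP /= addrACA IH addr0 !xmulX !linearZ /= !xmulX !jumpsU.
rewrite -!addmA [(U_(i) + _)%MM]addmC !scalerA -scalerDl.
rewrite !(mulrC _ c) -!mulrA -mulrDr [X in c * X](_ : _ = 0) ?mulr0 ?scale0r //.
rewrite !exprD.
move: ij; rewrite neq_ltn => /orP[ij|ji].
  by rewrite ij ltnNge ltnW //= mulr1 mulrN1 mulrN mulrC subrr.
by rewrite ji ltnNge ltnW //= mulr1 mulrN1 mulrN mulrC addNr.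
Qed.

(** The two signs agree because [x_i] itself does not count among the variables
that [x_i] passes. *)
Lemma xmul_sq i p : xmul i (xmul i p) = 'X_i ^+ 2 * p.
Proof.
elim/mpolyind: p => [|c m p _ _ IH]; first by rewrite !linear0 mulr0.
rewrite !linearP /= IH mulrDr -scalerAr xmulX linearZ /= xmulX jumpsU ltnn addn0.
rewrite [(-1) ^+ _ *: (_ *: _)]scalerA -expr2 sqrr_sign scale1r expr2 -!mpolyXD.
by rewrite -addmA [X in 'X_[X]]addmC.
Qed.

Fact xmul_skew_rel r : skew_rel r -> forall p, free_act xmul r p = 0.
Proof.
case=> i j ij p; rewrite free_actDl !free_actM !free_act_gen.
exact: xmul_anti.
Qed.

(** The coordinates of [f] in the ordered monomials, assembled into a commutative
polynomial. *)
Definition skew_symbol f : {mpoly K[n]} := pres_act xmul f 1.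

Fact skew_symbol_is_linear : linear skew_symbol.
Proof.
move=> c f g.
by rewrite /skew_symbol (pres_actDl xmul_skew_rel) (pres_actZl xmul_skew_rel).
Qed.
HB.instance Definition _ :=
  GRing.isLinear.Build K A {mpoly K[n]} *:%R skew_symbol skew_symbol_is_linear.

Lemma skew_symbol_sx i f : skew_symbol (sx K i * f) = xmul i (skew_symbol f).
Proof.
by rewrite /skew_symbol (pres_actM xmul_skew_rel) (pres_act_gen xmul_skew_rel).
Qed.

Lemma skew_symbol1 : skew_symbol 1 = 1.
Proof. exact: (pres_act1 xmul_skew_rel). Qed.

(** The product runs over the list [enum 'I_n], since the order of the factors
matters. *)
Definition ord_monomial : {linear {mpoly K[n]} -> A} :=
  monomial_lift (fun m => \prod_(j <- enum 'I_n) sx K j ^+ m j).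

Lemma ord_monomialX m : ord_monomial 'X_[m] = \prod_(j <- enum 'I_n) sx K j ^+ m j.
Proof. exact: monomial_liftX. Qed.

Lemma sx_expC i j a : i != j ->
  sx K i * sx K j ^+ a = (-1) ^+ a *: (sx K j ^+ a * sx K i).
Proof.
move=> ij; elim: a => [|a IH]; first by rewrite !expr0 scale1r mulr1 mul1r.
rewrite [sx K j ^+ _]exprS mulrA sxC // mulNr -(mulrA (sx K j) (sx K i)) IH.
by rewrite -pscalerAr mulrA exprS mulN1r scaleNr.
Qed.

(** Moving [x_i] from the left to its place picks up one sign for every smaller
variable that it passes; the list is arbitrary so that induction applies. *)
Lemma sx_mul_ordered i m (s : seq 'I_n) :
  sorted (fun j k : 'I_n => (j < k)%N) s -> i \in s ->
  sx K i * \prod_(j <- s) sx K j ^+ m j =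
  (-1) ^+ (\sum_(j <- s | (j < i)%N) m j) *:
    \prod_(j <- s) sx K j ^+ (m + U_(i))%MM j.
Proof.
elim: s => // j s IH; rewrite sorted_pairwise; last first.
  by move=> ? ? ?; apply: ltn_trans.
rewrite pairwise_cons -sorted_pairwise; last first.
  by move=> ? ? ?; apply: ltn_trans.
case/andP=> /allP js ss; rewrite inE; case: eqVneq => [-> _|ij /= si].
  have -> : (\sum_(l <- j :: s | (l < j)%N) m l = 0)%N.
    rewrite big_cons ltnn big_seq_cond big1 // => l /andP[/js /= jl].
    by rewrite ltnNge (ltnW jl).
  rewrite !big_cons scale1r mulrA -exprS mnmDE mnm1E eqxx addn1; congr (_ * _).
  rewrite !big_seq; apply: eq_bigr => l /js /= il.
  by rewrite mnmDE mnm1E -val_eqE /= ltn_eqF // addn0.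
rewrite !big_cons (js i si) mulrA sx_expC // -pscalerAl -mulrA IH //.
by rewrite -pscalerAr scalerA -exprD mnmDE mnm1E (negbTE ij) addn0.
Qed.

Lemma ord_monomial_xmul i p :
  ord_monomial (xmul i p) = sx K i * ord_monomial p.
Proof.
elim/mpolyind: p => [|c m p _ _ IH]; first by rewrite !linear0 mulr0.
rewrite !linearP /= IH mulrDr -pscalerAr xmulX linearZ /= !ord_monomialX.
congr (_ *: _ + _); apply/esym.
have -> : jumps i m = (\sum_(j <- enum 'I_n | (j < i)%N) m j)%N.
  by rewrite big_enum_cond.
apply: sx_mul_ordered; last by rewrite mem_enum.
by move: (iota_ltn_sorted 0 n); rewrite -val_enum_ord sorted_map.
Qed.

(** Hence ordered monomials are linearly independent: [xmul] turns a skew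
polynomial into its coordinates, and these determine it. *)
Lemma skew_symbolK : cancel skew_symbol ord_monomial.
Proof.
move=> f; elim/skew_poly_ind: f => [||c f g IHf IHg|i f IH].
- by rewrite !linear0.
- by rewrite skew_symbol1 -mpolyX0 ord_monomialX big1 // => j _; rewrite mnm0E.
- by rewrite !linearP IHf IHg.
- by rewrite skew_symbol_sx ord_monomial_xmul IH.
Qed.

Lemma skew_scalar_inj : injective (fun c : K => c *: (1 : A)).
Proof.
move=> c d /(congr1 skew_symbol); rewrite !linearZ /= skew_symbol1.
move=> /(congr1 (mcoeff 0%MM)); rewrite !mcoeffZ mcoeff1 eqxx.
by rewrite !mulr1.
Qed.
End SkewBasis.

(** On coordinates this is multiplication by the nonzero polynomial
[X_i^2 - X_k^2], in an integral domain. *)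
Lemma sx_sqB_inj (K : idomainType) n (i k : 'I_n) : k != i ->
  injective (fun f : skew_poly K n => (sx K i ^+ 2 - sx K k ^+ 2) * f).
Proof.
move=> ki f g /(congr1 (@skew_symbol K n)).
have E h : skew_symbol ((sx K i ^+ 2 - sx K k ^+ 2) * h) =
    ('X_i ^+ 2 - 'X_k ^+ 2) * skew_symbol h.
  by rewrite !expr2 !mulrBl linearB /= -!mulrA !skew_symbol_sx !xmul_sq !mulrA.
rewrite /= !E => /mulfI H; apply: (can_inj (@skew_symbolK K n)); apply: H.
rewrite subr_eq0; apply/eqP => /(congr1 (mcoeff (U_(i) *+ 2)%MM)).
rewrite !mpolyXn !mcoeffX eqxx; case: eqP => [/mnmP/(_ i)|_ /eqP]; last first.
  by rewrite oner_eq0.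
by rewrite !mulmnE !mnm1E eqxx (negbTE ki).
Qed.

(** * The numerators of the Dunkl operators *)

Section IndexMaps.
Variables (K : comNzRingType) (n : nat).
Notation A := (skew_poly K n).
Implicit Types (i j k : 'I_n) (f g : A).

Definition relabel (p : 'I_n -> 'I_n) f : A :=
  presmap (@skew_rel K n) (fun j => gen K (p j)) f.

Lemma swapE i k f : swap i k f = relabel (tperm i k) f.
Proof. by []. Qed.

Section OneMap.
Variables (p : 'I_n -> 'I_n) (p_inj : injective p).

Fact relabelP r : skew_rel r ->
  ppi (@skew_rel K n) (free_subst (fun j => gen K (p j)) r) = 0.
Proof.
case=> a b ab; rewrite raddfD /= 2!rmorphM /= 2!free_subst_gen.
by apply/ppi_rel/skew_rel_xi; rewrite (inj_eq p_inj).
Qed.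

Lemma relabel_sx j f : relabel p (sx K j * f) = sx K (p j) * relabel p f.
Proof. by rewrite /relabel (presmapM relabelP) (presmap_gen relabelP). Qed.

Lemma relabelZD c f g : relabel p (c *: f + g) = c *: relabel p f + relabel p g.
Proof. by rewrite /relabel (presmapD relabelP) (presmapZ relabelP). Qed.

Lemma relabel0 : relabel p 0 = 0.
Proof. by rewrite -(scale0r 0) /relabel (presmapZ relabelP) !scale0r. Qed.

Lemma relabel1 : relabel p 1 = 1.
Proof. exact: (presmap1 relabelP). Qed.

End OneMap.

Lemma relabel_comp p q f : injective p -> injective q ->
  relabel p (relabel q f) = relabel (p \o q) f.
Proof.
move=> pI qI; have pqI : injective (p \o q) by apply: inj_comp.
elim/skew_poly_ind: f => [||c f g IHf IHg|i f IH].
- by rewrite !relabel0.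
- by rewrite !relabel1.
- by rewrite !relabelZD // IHf IHg.
- by rewrite !relabel_sx // IH.
Qed.

Lemma eq_relabel p q f : p =1 q -> relabel p f = relabel q f.
Proof. by move=> pq; congr relabel; apply/funext. Qed.

Lemma relabel_id f : relabel id f = f.
Proof.
elim/skew_poly_ind: f => [||c f g IHf IHg|i f IH].
- by rewrite relabel0.
- by rewrite relabel1.
- by rewrite relabelZD // IHf IHg.
- by rewrite relabel_sx // IH.
Qed.

Lemma relabel_swap p i k f : injective p ->
  relabel p (swap i k f) = swap (p i) (p k) (relabel p f).
Proof.
move=> pI; rewrite !swapE !relabel_comp //; try exact: perm_inj.
by apply: eq_relabel => l /=; rewrite inj_tperm.
Qed.

Lemma swap_sxM i k j f : swap i k (sx K j * f) = sx K (tperm i k j) * swap i k f.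
Proof. by rewrite swapM swap_sx. Qed.

Fact swap_is_linear i k : linear (@swap K n i k).
Proof. by move=> c f g; rewrite swapD swapZ. Qed.
HB.instance Definition _ i k :=
  GRing.isLinear.Build K A A *:%R (swap i k) (swap_is_linear i k).

Fact tau_is_linear i : linear (@tau K n i).
Proof. by move=> c f g; rewrite tauD tauZ. Qed.
HB.instance Definition _ i :=
  GRing.isLinear.Build K A A *:%R (tau i) (tau_is_linear i).

Fact partial_is_linear i : linear (@partial K n i).
Proof.
move=> c f g; rewrite -(ppiK f) -(ppiK g) -ppiZ -raddfD !partialE.
by rewrite raddfD /= linearZ /= raddfD /= ppiZ.
Qed.
HB.instance Definition _ i :=
  GRing.isLinear.Build K A A *:%R (partial i) (partial_is_linear i).

Lemma partial1 i : partial i (1 : A) = 0.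
Proof.
by rewrite -(rmorph1 (ppi _)) partialE -word_nil free_partial_word
  /word_partial big_ord0 raddf0.
Qed.

Lemma partial_sx i j f :
  partial i (sx K j * f) = (if j == i then f else 0) - sx K j * partial i f.
Proof.
rewrite -(ppiK f) -ppiM !partialE free_partial_genM raddfB /= ppiM.
by case: eqP => // _; rewrite raddf0.
Qed.

(** Named so that left multiplication can carry a linear structure. *)
Definition lmul (a f : A) : A := a * f.

Fact lmul_is_linear a : linear (lmul a).
Proof. by move=> c f g; rewrite /lmul mulrDr -pscalerAr. Qed.
HB.instance Definition _ a :=
  GRing.isLinear.Build K A A *:%R (lmul a) (lmul_is_linear a).

Definition sqB i k : A := sx K i ^+ 2 - sx K k ^+ 2.

Lemma sx_sqC i j f : sx K i ^+ 2 * (sx K j * f) = sx K j * (sx K i ^+ 2 * f).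
Proof.
rewrite expr2 !mulrA; case: (eqVneq j i) => [->|ji] //.
rewrite (sxC _ ji) !mulNr -(mulrA (sx K i) (sx K j)) (sxC _ ji).
by rewrite mulrN !mulNr opprK mulrA.
Qed.

Lemma sqB_sx i k j f : sqB i k * (sx K j * f) = sx K j * (sqB i k * f).
Proof. by rewrite /sqB !mulrBl mulrBr !sx_sqC. Qed.

Fact dunkl_num_is_linear i k : linear (@dunkl_num K n i k).
Proof.
move=> c f g; rewrite /dunkl_num -!/(lmul _ _) !linearP /=.
rewrite [in RHS]scalerBr [RHS]addrACA -[in RHS]opprD.
by rewrite [in RHS]scalerBr [X in _ = _ - X]addrACA scalerN.
Qed.
HB.instance Definition _ i k :=
  GRing.isLinear.Build K A A *:%R (dunkl_num i k) (dunkl_num_is_linear i k).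

Lemma dunkl_num1 i k : dunkl_num i k (1 : A) = 0.
Proof. by rewrite /dunkl_num swap1 !tau1 !mulr1 subrr. Qed.

Lemma dunkl_num_other i k j f : j != i -> j != k ->
  dunkl_num i k (sx K j * f) = - (sx K j * dunkl_num i k f).
Proof.
move=> ji jk; rewrite /dunkl_num swap_sxM !tauM !tau_sx (negbTE ji) (negbTE jk).
rewrite tpermD 1?eq_sym // !mulrA !mulrBr !mulrBl.
rewrite !mulrA (sxC _ ji) (sxC _ jk).
rewrite !(mulNr, opprK, opprB, opprD) mulrBr !mulrA (sxC _ ji) (sxC _ jk).
rewrite !mulNr opprK opprD opprK [RHS]addrC; congr (_ + _).
exact: addrC.
Qed.

(** The minus sign comes, for the term in [tau_i f], from [tau_i] negating [x_i]
and, for the term in [tau_k f], from [x_i] and [x_k] anticommuting. In the term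
with the transposition the sign fails, and the error is [x_i^2 - x_k^2] times
the swapped polynomial. *)
Lemma dunkl_num_left i k f : k != i ->
  dunkl_num i k (sx K i * f) = - (sx K i * dunkl_num i k f) + sqB i k * swap i k f.
Proof.
move=> ki; rewrite /dunkl_num swap_sxM !tauM !tau_sx eqxx eq_sym (negbTE ki).
rewrite tpermL /sqB !expr2 !mulrA !mulrBr !mulrBl.
rewrite !(mulrN, mulNr) !mulrA (sxC _ ki) !(mulNr, opprK, opprB, opprD).
rewrite mulrBr !mulrA opprB -[RHS]addrA subrKA.
by rewrite [RHS]addrC; congr (_ + _); rewrite addrC.
Qed.

Lemma dunkl_num_right i k f : k != i ->
  dunkl_num i k (sx K k * f) = - (sx K k * dunkl_num i k f) + sqB i k * swap i k f.
Proof.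
move=> ki; rewrite /dunkl_num swap_sxM !tauM !tau_sx eqxx (negbTE ki).
rewrite tpermR /sqB !expr2 !mulrA !mulrBr !mulrBl.
rewrite !(mulrN, mulNr) !mulrA (sxC _ ki) !(mulNr, opprK, opprB, opprD).
rewrite mulrBr !mulrA (sxC _ ki) !mulNr opprB opprK -[RHS]addrA.
rewrite [sx K k * sx K k * _ + _]addrC [X in _ = _ + X]addrACA subrr addr0.
by rewrite [RHS]addrC [X in _ = X + _]addrC; congr (_ + _); exact: addrC.
Qed.
End IndexMaps.

(** * The Dunkl operators and their anticommutation *)

Section Dunkl.
Variables (K : idomainType) (n : nat).
Notation A := (skew_poly K n).
Implicit Types (i j k : 'I_n) (f g : A).

(** Every summand of the recursion for the numerator is visibly divisible, so
the quotient is built along the word. *)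
Lemma dunkl_quot_exists i k f : k != i -> exists g, sqB K i k * g = dunkl_num i k f.
Proof.
move=> ki; elim/skew_poly_ind: f => [||c f g [f' Hf] [g' Hg]|j f [f' Hf]].
- by exists 0; rewrite mulr0 linear0.
- by exists 0; rewrite mulr0 dunkl_num1.
- by exists (c *: f' + g'); rewrite mulrDr -pscalerAr Hf Hg linearP.
have [->|ji] := eqVneq j i.
  by exists (- (sx K i * f') + swap i k f);
    rewrite mulrDr mulrN sqB_sx Hf (dunkl_num_left _ ki).
have [->|jk] := eqVneq j k.
  by exists (- (sx K k * f') + swap i k f);
    rewrite mulrDr mulrN sqB_sx Hf (dunkl_num_right _ ki).
by exists (- (sx K j * f')); rewrite mulrN sqB_sx Hf (dunkl_num_other _ ji jk).
Qed.

Definition dquot i k f : A := skew_div (sqB K i k) (dunkl_num i k f).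

Lemma dquotP i k f : k != i -> sqB K i k * dquot i k f = dunkl_num i k f.
Proof.
move=> ki; have [g Hg] := dunkl_quot_exists f ki.
exact: (@xgetPex _ 0 [set g : A | sqB K i k * g = dunkl_num i k f]%classic
  (ex_intro _ g Hg)).
Qed.

(** Identities between quotients are proved by multiplying out. *)
Lemma dquot_unique i k f g : k != i -> sqB K i k * g = dunkl_num i k f ->
  dquot i k f = g.
Proof. by move=> ki Hg; apply: (sx_sqB_inj ki); rewrite /= dquotP. Qed.

Lemma dquot_linear i k c f g : k != i ->
  dquot i k (c *: f + g) = c *: dquot i k f + dquot i k g.
Proof.
move=> ki; apply: dquot_unique => //.
by rewrite mulrDr -pscalerAr !dquotP // linearP.
Qed.

Lemma dquot1 i k : k != i -> dquot i k 1 = 0.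
Proof. by move=> ki; apply: dquot_unique; rewrite // mulr0 dunkl_num1. Qed.

Lemma dquot_sx i k j f : k != i ->
  dquot i k (sx K j * f) =
  - (sx K j * dquot i k f) + (if (j == i) || (j == k) then swap i k f else 0).
Proof.
move=> ki; apply: dquot_unique => //; rewrite mulrDr mulrN sqB_sx dquotP //.
have [->|ji] := eqVneq j i; first by rewrite dunkl_num_left.
have [->|jk] := eqVneq j k; first by rewrite dunkl_num_right.
by rewrite dunkl_num_other // mulr0 addr0.
Qed.

Variables (t u : K).
Notation D := (dunkl t u).

Lemma dunklE i f : D i f =
  t *: partial i f + u *: \sum_(k < n | k != i) 2%:R *: dquot i k f.
Proof. by []. Qed.

Fact dunkl_is_linear i : linear (D i).
Proof.
move=> c f g; rewrite !dunklE linearP.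
rewrite (eq_bigr (fun k => c *: (2%:R *: dquot i k f) + 2%:R *: dquot i k g)).
  rewrite big_split /= -scaler_sumr !scalerDr addrACA !scalerA.
  by rewrite (mulrC t) (mulrC u).
by move=> k ki; rewrite dquot_linear // scalerDr !scalerA mulrC.
Qed.
HB.instance Definition _ i :=
  GRing.isLinear.Build K A A *:%R (D i) (dunkl_is_linear i).

Lemma dunklZ i c f : D i (c *: f) = c *: D i f.
Proof. exact: linearZ. Qed.

Lemma dunklD i f g : D i (f + g) = D i f + D i g.
Proof. exact: linearD. Qed.

Lemma dunklN i f : D i (- f) = - D i f.
Proof. exact: linearN. Qed.

Lemma dunkl1 i : D i 1 = 0.
Proof.
rewrite dunklE partial1 scaler0 add0r big1 ?scaler0 // => k ki.
by rewrite dquot1 ?scaler0.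
Qed.

(** The operator by which [eta_i xi_j + xi_j eta_i] has to act according to the
defining relations. *)
Definition anticomm i j f : A :=
  if j == i then t *: f + u *: \sum_(k < n | k != i) 2%:R *: swap i k f
  else u *: (2%:R *: swap i j f).

Lemma dunkl_sx i j f : D i (sx K j * f) = - (sx K j * D i f) + anticomm i j f.
Proof.
rewrite !dunklE partial_sx mulrDr -!pscalerAr mulr_sumr.
rewrite (eq_bigr (fun k => - (sx K j * (2%:R *: dquot i k f)) +
    2%:R *: (if (j == i) || (j == k) then swap i k f else 0))); last first.
  by move=> k ki; rewrite dquot_sx // scalerDr scalerN -pscalerAr.
rewrite big_split /= sumrN 2!scalerDr !scalerN opprD.
rewrite [t *: _ + _]addrC addrACA; congr (_ + _); rewrite /anticomm.
have [->|ji] := eqVneq j i; first by [].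
rewrite scaler0 add0r (bigD1 j) //= eqxx big1 ?addr0 // => k /andP[_ kj].
by rewrite eq_sym (negbTE kj) scaler0.
Qed.

Lemma relabel_anticomm p i j f : injective p ->
  relabel p (anticomm i j f) = anticomm (p i) (p j) (relabel p f).
Proof.
move=> pI; rewrite /anticomm (inj_eq pI).
have [_|ji] := eqVneq j i; last first.
  by rewrite /relabel !(presmapZ (relabelP pI)) -!/(relabel _ _) relabel_swap.
rewrite relabelZD // /relabel (presmapZ (relabelP pI)) -!/(relabel _ _).
congr (_ + _ *: _).
have RD (g h : A) : relabel p (g + h) = relabel p g + relabel p h.
  by rewrite -{1}(scale1r g) relabelZD // scale1r.
rewrite (big_morph (relabel p) RD (relabel0 K pI)) [RHS](reindex_inj pI) /=.
apply: eq_big => [k|k _]; first by rewrite (inj_eq pI).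
by rewrite /relabel (presmapZ (relabelP pI)) -!/(relabel _ _) relabel_swap.
Qed.

(** Both sides kill [1] and obey the same rule when moved past a generator. *)
Lemma relabel_dunkl p i f : injective p ->
  relabel p (D i f) = D (p i) (relabel p f).
Proof.
move=> pI; elim/skew_poly_ind: f => [||c f g IHf IHg|j f IH].
- by rewrite linear0 relabel0 // linear0.
- by rewrite dunkl1 relabel0 // relabel1 // dunkl1.
- rewrite dunkl_is_linear (relabelZD pI c (D i f)) (relabelZD pI c f).
  by rewrite IHf IHg dunkl_is_linear.
rewrite relabel_sx // !dunkl_sx -scaleN1r relabelZD // scaleN1r relabel_sx //.
by rewrite IH relabel_anticomm.
Qed.

Lemma swap_dunkl i k j f : swap i k (D j f) = D (tperm i k j) (swap i k f).
Proof. by rewrite !swapE relabel_dunkl //; apply: perm_inj. Qed.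

Lemma swapC i k f : swap i k f = swap k i f.
Proof. by rewrite !swapE tpermC. Qed.

(** Only the summand [k = i] of [anticomm j j] fails to commute with [D i]; the
transposition of [i] and [j] exchanges [D i] and [D j] there, and the other
term on each side compensates for this. *)
Lemma dunkl_anticomm_diag i j f : i != j ->
  D i (anticomm j j f) + D j (anticomm i j f) =
  anticomm i j (D j f) + anticomm j j (D i f).
Proof.
move=> ij; rewrite /anticomm eqxx [j == i]eq_sym (negbTE ij).
rewrite dunklD !dunklZ linear_sum /=.
rewrite (bigD1 i) //= [in RHS](bigD1 i) //=.
rewrite dunklZ !swap_dunkl !tpermR.
rewrite (eq_bigr (fun k => 2%:R *: swap j k (D i f))); last first.
  by move=> k /andP[kj ki]; rewrite dunklZ swap_dunkl tpermD // eq_sym.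
rewrite !(swapC j i).
move: (\sum_(k < n | (k != j) && (k != i)) 2%:R *: swap j k (D i f)) => S.
move: (D i f) (D i (swap i j f)) (D j (swap i j f)) => d a b.
rewrite !scalerDr [RHS]addrCA -!addrA; congr (_ + (_ + _)); exact: addrC.
Qed.

(** The obstruction to [D i D j + D j D i] commuting with [x_k]. Apart from the
two diagonal cases, all terms are transpositions that fix one of the indices
[i] and [j], and equivariance applies directly. *)
Lemma dunkl_anticomm i j k f : i != j ->
  D i (anticomm j k f) + D j (anticomm i k f) =
  anticomm i k (D j f) + anticomm j k (D i f).
Proof.
move=> ij; have [->|kj] := eqVneq k j; first exact: dunkl_anticomm_diag.
have [->|ki] := eqVneq k i.
  by rewrite addrC dunkl_anticomm_diag 1?eq_sym // addrC.
rewrite /anticomm (negbTE ki) (negbTE kj) !swap_dunkl.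
rewrite !tpermD // 1?[k == _]eq_sym // 1?[j == i]eq_sym //.
by rewrite !dunklZ; exact: addrC.
Qed.

(** The operator commutes with each [x_k] and kills [1]. *)
Lemma dunkl_anti i j f : i != j -> D i (D j f) + D j (D i f) = 0.
Proof.
move=> ij; elim/skew_poly_ind: f => [||c f g IHf IHg|k f IH].
- by rewrite !linear0 addr0.
- by rewrite !dunkl1 !linear0 addr0.
- rewrite (dunkl_is_linear j c f) (dunkl_is_linear i c f).
  rewrite (dunkl_is_linear i c (D j f)) (dunkl_is_linear j c (D i f)).
  by rewrite addrACA -scalerDr IHf IHg scaler0 addr0.
have step a b : D a (D b (sx K k * f)) =
    sx K k * D a (D b f) + (D a (anticomm b k f) - anticomm a k (D b f)).
  rewrite dunkl_sx dunklD dunklN dunkl_sx opprD opprK -[LHS]addrA.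
  by congr (_ + _); exact: addrC.
rewrite !step addrACA -mulrDr IH mulr0 add0r addrACA dunkl_anticomm //.
by rewrite -opprD subrr.
Qed.
End Dunkl.

(** * The algebra acts on the skew polynomials *)

Section WeylAction.
Variables (n : nat).
Implicit Types (s r : [subg WD n]) (i k j : 'I_n).

Lemma wstar_signed s i b :
  val s (i, b) = (wstar (val s) i, b (+) (val s (i, false)).2).
Proof. by have /WDP[-> _] := valP s. Qed.

Lemma wstar_inj s : injective (wstar (val s)).
Proof.
move=> i k ik; suff [] : (i, (val s (i, false)).2) = (k, (val s (k, false)).2) by [].
apply: (@perm_inj _ (val s)).
by rewrite (wstar_signed s i (val s (i, false)).2)
  (wstar_signed s k (val s (k, false)).2) ik !addbb.
Qed.

Lemma wstar1 i : wstar (val (1%g : [subg WD n])) i = i.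
Proof. by rewrite /wstar perm1. Qed.

Lemma wstarM r s i : wstar (val (r * s)%g) i = wstar (val s) (wstar (val r) i).
Proof.
by rewrite {1}/wstar /= permM (wstar_signed r i false) (wstar_signed s (wstar _ i)).
Qed.

Lemma wstar_refl i k j : wstar (val (s_ i k)) j = tperm i k j.
Proof. by rewrite /wstar /= permE. Qed.

Lemma wstar_nrefl i k j : wstar (val (sbar i k)) j = tperm i k j.
Proof. by rewrite /wstar /= permE. Qed.

Variable K : comNzRingType.
Notation A := (skew_poly K n).

Definition weyl_act s : A -> A := relabel (wstar (val s)).

Fact weyl_act_is_linear s : linear (weyl_act s).
Proof. by move=> c f g; apply: relabelZD; apply: wstar_inj. Qed.
HB.instance Definition _ s :=
  GRing.isLinear.Build K A A *:%R (weyl_act s) (weyl_act_is_linear s).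

Lemma weyl_act_refl i k f : weyl_act (s_ i k) f = swap i k f.
Proof. exact/eq_relabel/wstar_refl. Qed.

Lemma weyl_act_nrefl i k f : weyl_act (sbar i k) f = swap i k f.
Proof. exact/eq_relabel/wstar_nrefl. Qed.
End WeylAction.

Section DahaAction.
Variables (K : idomainType) (n : nat) (t u : K).
Notation A := (skew_poly K n).
Notation H := (daha n t u).
Notation D := (dunkl t u).

Definition daha_op (x : daha_gen n) : {linear A -> A} :=
  match x with
  | inl (inl i) => lmul (sx K i)
  | inl (inr i) => D i
  | inr s => weyl_act s
  end.

Lemma daha_op_xi i f : free_act daha_op (gxi K i) f = sx K i * f.
Proof. exact: free_act_gen. Qed.

Lemma daha_op_eta i f : free_act daha_op (geta K i) f = D i f.
Proof. exact: free_act_gen. Qed.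

Lemma daha_op_w s f : free_act daha_op (gw K s) f = weyl_act s f.
Proof. exact: free_act_gen. Qed.

Let opE := (daha_op_xi, daha_op_eta, daha_op_w).

(** The relations between [eta_i] and [eta_j] hold by [dunkl_anti], those between
[eta_i] and [xi_j] by [dunkl_sx], and those with the group by equivariance. *)
Lemma daha_op_rel r : daha_rel t u r -> forall f, free_act daha_op r f = 0.
Proof.
case=> [|s r'|i j ij|i j ij|s j|s j|i j ij|i] f;
  rewrite ?(free_actDl, free_actNl, free_actM, opE).
- rewrite free_act1 /weyl_act (eq_relabel _ (@wstar1 n)) relabel_id.
  exact: subrr.
- rewrite /weyl_act relabel_comp; try exact: wstar_inj.
  by apply/eqP; rewrite subr_eq0; apply/eqP/eq_relabel => k; rewrite wstarM.
- exact: dunkl_anti.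
- rewrite !mulrA (sxC _ ij) mulNr; exact: addNr.
- by rewrite /weyl_act relabel_sx ?subrr //; apply: wstar_inj.
- by rewrite /weyl_act relabel_dunkl ?subrr //; apply: wstar_inj.
- rewrite free_actZl free_actDl !opE weyl_act_refl weyl_act_nrefl dunkl_sx.
  rewrite /anticomm eq_sym (negbTE ij) [X in X - _]addrAC addNr add0r.
  by rewrite scaler_nat mulr2n subrr.
rewrite !free_actZl free_act1 free_act_sum (eq_bigr (fun k => 2%:R *: swap i k f)).
  by rewrite dunkl_sx [X in X - _]addrAC addNr add0r /anticomm eqxx subrr.
move=> k _.
by rewrite free_actDl !opE weyl_act_refl weyl_act_nrefl swapC scaler_nat mulr2n.
Qed.

Definition daha_act : H -> A -> A := pres_act daha_op.
HB.instance Definition _ h := GRing.Linear.on (daha_act h).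

Lemma daha_actM x y f : daha_act (x * y) f = daha_act x (daha_act y f).
Proof. exact: (pres_actM daha_op_rel). Qed.
Lemma daha_actD x y f : daha_act (x + y) f = daha_act x f + daha_act y f.
Proof. exact: (pres_actDl daha_op_rel). Qed.
Lemma daha_actZ c x f : daha_act (c *: x) f = c *: daha_act x f.
Proof. exact: (pres_actZl daha_op_rel). Qed.
Lemma daha_act1 f : daha_act 1 f = f.
Proof. exact: (pres_act1 daha_op_rel). Qed.
Lemma daha_act_xi i f : daha_act (xi t u i) f = sx K i * f.
Proof. exact: (pres_act_gen daha_op_rel). Qed.
Lemma daha_act_eta i f : daha_act (eta t u i) f = D i f.
Proof. exact: (pres_act_gen daha_op_rel). Qed.
Lemma daha_act_w s f : daha_act (wgt t u s) f = weyl_act s f.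
Proof. exact: (pres_act_gen daha_op_rel). Qed.

End DahaAction.

(** * The character of the subalgebra and the one-dimensional module *)

Section SubalgInduction.
Variables (K : comNzRingType) (I : choiceType) (rel : free_alg K I -> Prop).
Variable G : presalg rel -> Prop.

(** The constructor [Subalg] carries a membership proof, so the predicate is first
extended to the ambient algebra by quantifying over such proofs. *)
Lemma subalg_ind (P : subalg G -> Prop) :
  (forall c, P (Subalg (subalg_gen_scalar G c))) ->
  (forall a b, P a -> P b -> P (a - b)) ->
  (forall a b, P a -> P b -> P (a * b)) ->
  (forall x (Gx : G x), P (Subalg (mem_subalg_gen Gx))) -> forall a, P a.
Proof.
move=> Pc PB PM PG [x px].
pose S : {pred presalg rel} :=
  fun y => `[< exists py : y \in subalg_gen G, P (Subalg py) >].
have SE y (a : subalg G) : P a -> val a = y -> y \in S.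
  by case: a => z pz Pz /= <-; apply/asboolP; exists pz.
have : x \in S.
  move/asboolP: (px); apply; last by move=> y Gy; apply: SE (PG _ Gy) _.
  split; first split.
  - by apply: SE (Pc 1) _; rewrite /= scale1r.
  - by move=> y z /asboolP[py Py] /asboolP[pz Pz]; apply: SE (PB _ _ Py Pz) _.
  - by move=> y z /asboolP[py Py] /asboolP[pz Pz]; apply: SE (PM _ _ Py Pz) _.
  - move=> c y /asboolP[py Py]; apply: SE (PM _ _ (Pc c) Py) _.
    by rewrite /= -pscalerAl mul1r.
case/asboolP=> px' Px'; rewrite (_ : Subalg px = Subalg px') //.
exact: val_inj.
Qed.
End SubalgInduction.

Section Character.
Variables (K : idomainType) (n : nat) (t u : K).
Notation A := (skew_poly K n).
Notation S := (heta n t u).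

Lemma heta_ind (P : S -> Prop) :
  (forall c, P (scalar_h n t u c)) ->
  (forall a b, P a -> P b -> P (a - b)) ->
  (forall a b, P a -> P b -> P (a * b)) ->
  (forall i, P (eta_h t u i)) -> (forall s, P (w_h t u s)) -> forall a, P a.
Proof.
move=> Pc PB PM Pe Pw; apply: subalg_ind => // x [i|s].
- exact: Pe.
- exact: Pw.
Qed.

(** The group fixes [1] and the Dunkl operators kill it, so the subalgebra
preserves the line through [1]. *)
Lemma heta_act_one (a : S) : exists c, daha_act (val a) 1 = c *: (1 : A).
Proof.
elim/heta_ind: a => [c|a b [c Hc] [d Hd]|a b [c Hc] [d Hd]|i|s].
- by exists c; rewrite daha_actZ daha_act1.
- exists (c - d); rewrite raddfB /= -scaleN1r addrC daha_actD daha_actZ Hc Hd.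
  by rewrite scaleN1r addrC scalerBl.
- by exists (c * d); rewrite rmorphM /= daha_actM Hd linearZ /= Hc scalerA mulrC.
- by exists 0; rewrite daha_act_eta dunkl1 scale0r.
- exists 1; rewrite daha_act_w scale1r; exact/relabel1/wstar_inj.
Qed.

(** Reading the character off from the action on [1] makes it multiplicative
without a presentation of the subalgebra by generators and relations. *)
Definition chi (a : S) : K := sval (cid (heta_act_one a)).

Lemma chiP a : daha_act (val a) 1 = chi a *: (1 : A).
Proof. exact: svalP (cid (heta_act_one a)). Qed.

Lemma chi_unique a c : daha_act (val a) 1 = c *: (1 : A) -> chi a = c.
Proof. by rewrite chiP => /skew_scalar_inj. Qed.

Lemma chiD a b : chi (a + b) = chi a + chi b.
Proof. by apply: chi_unique; rewrite raddfD /= daha_actD !chiP scalerDl. Qed.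

Lemma chiM a b : chi (a * b) = chi a * chi b.
Proof.
apply: chi_unique.
by rewrite rmorphM /= daha_actM !chiP linearZ /= chiP scalerA mulrC.
Qed.

Lemma chi_scalar c : chi (scalar_h n t u c) = c.
Proof. by apply: chi_unique; rewrite /= daha_actZ daha_act1. Qed.

Lemma chi1 : chi 1 = 1.
Proof. by apply: chi_unique; rewrite rmorph1 daha_act1 scale1r. Qed.

Lemma chi_eta i : chi (eta_h t u i) = 0.
Proof. by apply: chi_unique; rewrite daha_act_eta dunkl1 scale0r. Qed.

Lemma chi_w s : chi (w_h t u s) = 1.
Proof.
by apply: chi_unique; rewrite daha_act_w scale1r; exact/relabel1/wstar_inj.
Qed.

Definition chi_scale (a : S) (v : K) : K := chi a * v.

Fact chi_scaleA a b v : chi_scale a (chi_scale b v) = chi_scale (a * b) v.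
Proof. by rewrite /chi_scale chiM mulrA. Qed.
Fact chi_scale1 : left_id 1 chi_scale.
Proof. by move=> v; rewrite /chi_scale chi1 mul1r. Qed.
Fact chi_scaleDr : right_distributive chi_scale +%R.
Proof. by move=> a v w; apply: mulrDr. Qed.
Fact chi_scaleDl v : {morph chi_scale^~ v : a b / a + b}.
Proof. by move=> a b; rewrite /chi_scale chiD; apply: mulrDl. Qed.

Definition chi_module : lmodType S := HB.pack (GRing.IntegralDomain.sort K)
  (GRing.Zmodule_isLmodule.Build S K chi_scaleA chi_scale1 chi_scaleDr chi_scaleDl).

Lemma chi_module_trivial : is_trivial_module ((1 : K) : chi_module).
Proof.
have chiE a (v : K) : a *: (v : chi_module) = chi a * v by [].
split=> [|v|s v|i v].
- exact/eqP/oner_neq0.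
- by exists v; rewrite chiE chi_scalar mulr1.
- by rewrite chiE chi_w mul1r.
- by rewrite chiE chi_eta mul0r.
Qed.
End Character.

(** * The induced module *)

Section InducedModule.
Variables (K : fieldType) (n : nat) (t u : K).
Notation A := (skew_poly K n).
Notation H := (daha n t u).
Notation S := (heta n t u).
Variables (V : lmodType S) (v0 : V) (triv : is_trivial_module v0).
Implicit Types (i j k : 'I_n) (s : [subg WD n]) (f g : A).

Lemma skew_ind_xi i f : skew_ind v0 (sx K i * f) = xi t u i *: skew_ind v0 f.
Proof. by rewrite /skew_ind skew_inclM skew_incl_sx [RHS]scale_tens. Qed.

Lemma skew_indD f g : skew_ind v0 (f + g) = skew_ind v0 f + skew_ind v0 g.
Proof. by rewrite /skew_ind skew_inclD tensDl. Qed.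

Lemma skew_indZ c f : skew_ind v0 (c *: f) = (c *: (1 : H)) *: skew_ind v0 f.
Proof. by rewrite /skew_ind skew_inclZ [RHS]scale_tens -pscalerAl mul1r. Qed.

Lemma skew_ind0 : skew_ind v0 0 = 0.
Proof. by rewrite -(scale0r 0) skew_indZ !scale0r. Qed.

Lemma skew_indN f : skew_ind v0 (- f) = - skew_ind v0 f.
Proof. by apply/eqP; rewrite -addr_eq0 -skew_indD addNr skew_ind0. Qed.

Lemma tens0 (h : H) : tens (@heta_incl K n t u) h (0 : V) = 0.
Proof.
have /eqP := tensDr (@heta_incl K n t u) h (0 : V) 0.
by rewrite addr0 -subr_eq0 opprD addrA subrr sub0r oppr_eq0 => /eqP.
Qed.

Lemma eta_skew_ind1 i : eta t u i *: skew_ind v0 1 = 0.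
Proof.
have [_ _ _ Ve] := triv.
rewrite /skew_ind skew_incl1 [LHS]scale_tens mulr1 -[eta t u i]mul1r.
by rewrite (tens_bal (@heta_incl K n t u) 1 (eta_h t u i)) Ve tens0.
Qed.

Lemma w_skew_ind1 s : wgt t u s *: skew_ind v0 1 = skew_ind v0 1.
Proof.
have [_ _ Vw _] := triv.
rewrite /skew_ind skew_incl1 [LHS]scale_tens mulr1 -[wgt t u s]mul1r.
by rewrite (tens_bal (@heta_incl K n t u) 1 (w_h t u s)) Vw.
Qed.

Lemma wgt_xi s j : wgt t u s * xi t u j = xi t u (wstar (val s) j) * wgt t u s.
Proof. by rewrite -!ppiM; apply/ppi_eq/daha_w_xi. Qed.

Lemma eta_xi i j : i != j -> eta t u i * xi t u j =
  - (xi t u j * eta t u i) + u *: (wgt t u (s_ i j) + wgt t u (sbar i j)).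
Proof.
move=> ij; have := ppi_eq (daha_eta_xi t u ij).
rewrite ppiZ !raddfD /= !ppiM => <-.
by rewrite addrC addrK.
Qed.

Lemma eta_xi_diag i : eta t u i * xi t u i = - (xi t u i * eta t u i) +
  (t *: (1 : H) +
    u *: \sum_(k < n | k != i) (wgt t u (s_ k i) + wgt t u (sbar k i))).
Proof.
have := ppi_eq (daha_eta_xi_diag t u i).
rewrite !raddfD /= !ppiM !ppiZ rmorph1 raddf_sum /=.
under eq_bigr do rewrite raddfD /=.
by move=> <-; rewrite addrC addrK.
Qed.

Lemma skew_ind_w s f : wgt t u s *: skew_ind v0 f = skew_ind v0 (weyl_act s f).
Proof.
elim/skew_poly_ind: f => [||c f g IHf IHg|j f IH].
- by rewrite linear0 skew_ind0 scaler0.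
- by rewrite w_skew_ind1 /weyl_act relabel1 //; apply: wstar_inj.
- rewrite linearP /= !skew_indD !skew_indZ scalerDr -IHf -IHg !scalerA.
  by rewrite -pscalerAl -pscalerAr mul1r mulr1.
rewrite /weyl_act relabel_sx; last exact: wstar_inj.
by rewrite !skew_ind_xi !scalerA wgt_xi -!scalerA IH.
Qed.

(** In the induced module [eta_i] kills the generator and moves past [xi_j] as
[D i] moves past [x_j]. *)
Lemma skew_ind_eta i f : eta t u i *: skew_ind v0 f = skew_ind v0 (dunkl t u i f).
Proof.
elim/skew_poly_ind: f => [||c f g IHf IHg|j f IH].
- by rewrite linear0 skew_ind0 scaler0.
- by rewrite eta_skew_ind1 dunkl1 skew_ind0.
- rewrite dunkl_is_linear (skew_indD (c *: f)) (skew_indD (c *: _)) !skew_indZ.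
  rewrite -IHf -IHg scalerDr !scalerA.
  by rewrite -pscalerAl -pscalerAr mul1r mulr1.
rewrite skew_ind_xi scalerA dunkl_sx skew_indD skew_indN skew_ind_xi -IH scalerA.
have Hu (c : K) (x : H) :
    (c *: x) *: skew_ind v0 f = (c *: (1 : H)) *: (x *: skew_ind v0 f).
  by rewrite scalerA -pscalerAl mul1r.
rewrite /anticomm; have [->|ji] := eqVneq j i.
  rewrite eta_xi_diag !scalerDl scaleNr; congr (_ + _).
  rewrite skew_indD !skew_indZ (Hu u); congr (_ + _ *: _).
  rewrite scaler_suml (big_morph (skew_ind v0) skew_indD skew_ind0).
  apply: eq_bigr => k _; rewrite scaler_nat mulr2n skew_indD scalerDl !skew_ind_w.
  by rewrite weyl_act_refl weyl_act_nrefl swapC.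
rewrite eta_xi 1?eq_sym // scalerDl scaleNr skew_indZ; congr (_ + _).
rewrite (Hu u) scalerDl !skew_ind_w weyl_act_refl weyl_act_nrefl.
by rewrite scaler_nat mulr2n skew_indD.
Qed.

Lemma skew_ind_act h f : h *: skew_ind v0 f = skew_ind v0 (daha_act h f).
Proof.
elim/pres_ind: h f => [f|f|c x y IHx IHy f|[[i|i]|s] x IH f].
- rewrite scale0r -[daha_act _ _](_ : 0 = _) ?skew_ind0 //.
  by have := daha_actZ 0 (0 : H) f; rewrite !scale0r.
- by rewrite daha_act1 scale1r.
- by rewrite daha_actD daha_actZ skew_indD skew_indZ -IHx -IHy scalerDl scalerA
    -pscalerAl mul1r.
- by rewrite daha_actM daha_act_xi skew_ind_xi -IH scalerA.
- by rewrite daha_actM daha_act_eta -skew_ind_eta -IH scalerA.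
- by rewrite daha_actM daha_act_w -skew_ind_w -IH scalerA.
Qed.

Lemma daha_act_incl f : daha_act (skew_incl t u f) 1 = f.
Proof.
elim/skew_poly_ind: f => [||c f g IHf IHg|j f IH].
- have := skew_inclZ t u 0 (0 : A); rewrite !scale0r => ->.
  by have := daha_actZ 0 (0 : H) (1 : A); rewrite !scale0r.
- by rewrite skew_incl1 daha_act1.
- by rewrite skew_inclD skew_inclZ daha_actD daha_actZ IHf IHg.
- by rewrite skew_inclM skew_incl_sx daha_actM daha_act_xi IH.
Qed.

Lemma scalar_hK c : c != 0 -> scalar_h n t u c^-1 * scalar_h n t u c = 1.
Proof.
by move=> c0; apply: val_inj; rewrite rmorphM rmorph1 /= -pscalerAl mul1r
  scalerA mulVf // scale1r.
Qed.

Lemma scalar_v0_inj c d : scalar_h n t u c *: v0 = scalar_h n t u d *: v0 -> c = d.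
Proof.
have [nz _ _ _] := triv; move=> /eqP; rewrite -subr_eq0 -scalerBl.
have -> : scalar_h n t u c - scalar_h n t u d = scalar_h n t u (c - d).
  by apply: val_inj; rewrite raddfB /= scalerBl.
have [/eqP|cd /eqP E] := eqVneq (c - d) 0; first by rewrite subr_eq0 => /eqP.
by case: nz; rewrite -[v0]scale1r -(scalar_hK cd) -scalerA E scaler0.
Qed.

Lemma trivial_coord_exists (v : V) : exists c, v = scalar_h n t u c *: v0.
Proof. by have [_ + _ _] := triv; apply. Qed.

Definition coord (v : V) : K := sval (cid (trivial_coord_exists v)).

Lemma coordP v : v = scalar_h n t u (coord v) *: v0.
Proof. exact: svalP (cid (trivial_coord_exists v)). Qed.

Lemma coord_unique v c : v = scalar_h n t u c *: v0 -> coord v = c.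
Proof. by rewrite {1}(coordP v) => /scalar_v0_inj. Qed.

Lemma coordD v w : coord (v + w) = coord v + coord w.
Proof.
apply: coord_unique; rewrite {1}(coordP v) {1}(coordP w) -scalerDl.
by congr (_ *: _); apply: val_inj; rewrite raddfD /= scalerDl.
Qed.

Lemma scalar_h1 : scalar_h n t u 1 = 1.
Proof. by apply: val_inj; rewrite [RHS]rmorph1 /= scale1r. Qed.

(** A trivial module is determined by its description on generators, so it must be
the one given by [chi]. *)
Lemma scale_chi (a : S) (v : V) : a *: v = scalar_h n t u (chi a) *: v.
Proof.
have [_ _ Vw Ve] := triv.
elim/heta_ind: a v => [c|a b Ha Hb|a b Ha Hb|i|s] v.
- by rewrite chi_scalar.
- rewrite scalerBl Ha Hb -scalerBl; congr (_ *: _); apply: val_inj.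
  rewrite raddfB /= -scalerBl; congr (_ *: _).
  by apply: (addIr (chi b)); rewrite subrK -chiD subrK.
- rewrite -scalerA Hb Ha scalerA; congr (_ *: _); apply: val_inj.
  by rewrite rmorphM /= -pscalerAl mul1r scalerA chiM.
- rewrite Ve chi_eta (_ : scalar_h n t u 0 = 0) ?scale0r //.
  by apply: val_inj; rewrite [RHS]raddf0 /= scale0r.
- by rewrite Vw chi_w scalar_h1 scale1r.
Qed.

Lemma coordZ (a : S) v : coord (a *: v) = chi a * coord v.
Proof.
by apply: coord_unique; rewrite {1}(coordP v) scalerA scale_chi chiM chi_scalar.
Qed.

(** The inverse of the identification, before passing to the tensor product. The
values are taken in [zmodule A], the skew polynomials as a module over the
integers, because the tensor product is a quotient of a free abelian group. *)
Definition ind_lift_fun (p : H * V) : zmodule A := daha_act p.1 (coord p.2 *: (1 : A)).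

Definition ind_lift : free_mod int (H * V)%type -> zmodule A := flift ind_lift_fun.
HB.instance Definition _ := GRing.Additive.on ind_lift.

Lemma ind_lift_ker (x : free_mod int (H * V)%type) :
  x \in tensor_ker (V := V) (@heta_incl K n t u) -> ind_lift x = 0.
Proof.
move=> /asboolP /(_ (fun x => ind_lift x == 0)) H0; apply/eqP; apply: H0.
  split; first by rewrite unfold_in raddf0.
  by move=> y z /eqP Hy /eqP Hz; rewrite unfold_in raddfB /= Hy Hz subrr.
have base h v : ind_lift (tbase h v) = ind_lift_fun (h, v) by exact: flift_base.
move=> r [h h' v|h v v'|h a v]; rewrite unfold_in raddfB ?(raddfD ind_lift) /= !base
  subr_eq0 /ind_lift_fun /=; apply/eqP.
- exact: daha_actD.
- by rewrite coordD scalerDl linearD.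
- by rewrite coordZ daha_actM !linearZ /= chiP linearZ /= scalerA mulrC.
Qed.

Definition ind_skew (x : ind_heta V) : A := ind_lift (repr x).

Lemma ind_skew_tpi x : ind_skew (tpi (@heta_incl K n t u) x) = ind_lift x.
Proof.
apply/eqP; rewrite -subr_eq0 -[X in X == 0](raddfB ind_lift) /=; apply/eqP.
by apply: ind_lift_ker; apply/eq_tpi; rewrite tpiK.
Qed.

Lemma ind_skew_tens h v :
  ind_skew (tens (@heta_incl K n t u) h v) = daha_act h (coord v *: (1 : A)).
Proof. by rewrite /tens ind_skew_tpi /tbase /ind_lift flift_base. Qed.

Lemma skew_indK : cancel (skew_ind v0) ind_skew.
Proof.
move=> f; rewrite ind_skew_tens (coord_unique (c := 1)) ?scale1r ?daha_act_incl //.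
by rewrite scalar_h1 scale1r.
Qed.

Fact skew_ind_is_zmod_morphism : zmod_morphism (skew_ind v0).
Proof. by move=> f g; rewrite skew_indD skew_indN. Qed.
HB.instance Definition _ := GRing.isZmodMorphism.Build A (ind_heta V)
  (skew_ind v0) skew_ind_is_zmod_morphism.

(** Every tensor is the image of a skew polynomial: transport the action of [h]
through the identification. *)
Lemma tens_skew_ind (h : H) v :
  tens (@heta_incl K n t u) h v = skew_ind v0 (daha_act h (coord v *: (1 : A))).
Proof.
rewrite {1}(coordP v) -tens_bal -skew_ind_act skew_indZ /skew_ind skew_incl1.
by rewrite [in RHS]scale_tens [RHS]scale_tens mulr1.
Qed.

Lemma ind_skewK : cancel ind_skew (skew_ind v0).
Proof.
move=> x; suff [f ->] : exists f, x = skew_ind v0 f by rewrite skew_indK.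
elim/induced_ind: x => [|c h v x [f ->]]; first by exists 0; rewrite skew_ind0.
exists (daha_act h (coord v *: (1 : A)) *~ c + f).
by rewrite raddfD raddfMz /= -tens_skew_ind.
Qed.

Lemma skew_ind_bij : bijective (skew_ind v0).
Proof. exact: Bijective skew_indK ind_skewK. Qed.
End InducedModule.

Theorem theorem5p14 (R : realType) (n : nat) (t u : R[i]) :
  [/\ (* the division in the Dunkl operators is well defined *)
      forall (i k : 'I_n) (f : skew_poly R[i] n), k != i ->
        exists! g : skew_poly R[i] n,
          (sx R[i] i ^+ 2 - sx R[i] k ^+ 2) * g = dunkl_num i k f,
      (* the module V exists *)
      exists (V : lmodType (heta n t u)) (v0 : V), is_trivial_module v0
    & forall (V : lmodType (heta n t u)) (v0 : V), is_trivial_module v0 ->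
        bijective (skew_ind v0) /\
        forall (i : 'I_n) (f : skew_poly R[i] n),
          eta t u i *: skew_ind v0 f = skew_ind v0 (dunkl t u i f)].
Proof.
split=> [i k f ki||V v0 triv].
- exists (dquot i k f); split; first exact: dquotP.
  by move=> g; apply: dquot_unique.
- by exists (chi_module n t u), 1; apply: chi_module_trivial.
split; first exact: skew_ind_bij triv.
by move=> i f; apply: skew_ind_eta.
Qed.
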